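(* Let $R=\bigoplus_{\gamma\in\Gamma}R_\gamma$ be a $\Gamma$-graded $K$-algebra, where $\Gamma$ is an ordered semigroup ordered by a well-ordering, and suppose that $R$ has a two-sided Gröbner basis theory with respect to an admissible system $(\mathcal{B},\prec_{gr})$, where $\mathcal{B}$ is a skew multiplicative $K$-basis of $R$ consisting of $\Gamma$-homogeneous elements and $\prec_{gr}$ is a $\Gamma$-graded two-sided monomial ordering on $\mathcal{B}$. Let $I$ be an arbitrary proper ideal of $R$, and put $A=R/I$, $A^{\Gamma}_{\rm LH}=R/\langle\mathbf{LH}(I)\rangle$. Suppose, for one fixed choice of side (left, right, or two-sided), that (a) $A^{\Gamma}_{\rm LH}$ is a domain; and (b) $A^{\Gamma}_{\rm LH}$ has a (left, right, or two-sided) Gröbner basis theory with respect to some (left, right, or two-sided) admissible system $(\widehat{N(I)},\prec_{\widehat{gr}})$, where $\prec_{\widehat{gr}}$ is a $\Gamma$-graded (left, right, or two-sided) monomial ordering on $\widehat{N(I)}$, such that every $\Gamma$-graded (left, right, or two-sided) ideal of $A^{\Gamma}_{\rm LH}$ has a (left, right, or two-sided) Gröbner basis consisting of $\Gamma$-homogeneous elements. Then the order $\prec$ on $\overline{N(I)}$ defined by: for $\bar u,\bar v\in\overline{N(I)}$ (with $u,v\in N(I)$), $$\bar u\prec\bar v\ \text{ whenever }\ \hat u\prec_{\widehat{gr}}\hat v,$$ is a (left, right, or two-sided) monomial ordering on $\overline{N(I)}$, such that every (left, right, or two-sided) ideal of $A$ has a (left, right, or two-sided) Gröbner basis.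
   Context: $K$ is a field, $K^*=K\setminus\{0\}$; a $K$-algebra is a finitely generated associative $K$-algebra with identity $1$; ''ideal'' without qualification means two-sided ideal; $\langle S\rangle$ is the two-sided ideal generated by $S$. An ordered semigroup is a semigroup with a total ordering $<$ compatible with multiplication ($\gamma_1<\gamma_2$ implies $\gamma\gamma_1<\gamma\gamma_2$ and $\gamma_1\gamma<\gamma_2\gamma$). A skew multiplicative $K$-basis of a $K$-algebra is a $K$-basis $\mathcal{B}$, consisting of products of powers of the generators, such that for all $u,v\in\mathcal{B}$ either $uv=0$ or $uv=\lambda w$ with $\lambda\in K^*$, $w\in\mathcal{B}$. Let $\mathscr{B}$ be any $K$-basis of a $K$-algebra $\Lambda$ (not necessarily skew multiplicative). Given a well-ordering $\prec$ on $\mathscr{B}$ and $0\ne f=\sum_{i=1}^s\lambda_iu_i$ with $\lambda_i\in K^*$, $u_i\in\mathscr{B}$, $u_1\prec\cdots\prec u_s$, put $\mathbf{LM}(f)=u_s$; $\mathbf{LM}(0)=0$. The well-ordering $\prec$ is a two-sided monomial ordering if: (MO1) whenever $w,u,v,s\in\mathscr{B}$, $w\prec u$ and $\mathbf{LM}(vws),\mathbf{LM}(vus)\notin K^*\cup\{0\}$, then $\mathbf{LM}(vws)\prec\mathbf{LM}(vus)$; (MO2) for $w,u\in\mathscr{B}$, if $u=\mathbf{LM}(vws)$ for some $v,s\in\mathscr{B}$ with $v\ne1$ or $s\ne1$ (in case $1\in\mathscr{B}$), then $w\prec u$. It is a left monomial ordering if: whenever $w,u,v\in\mathscr{B}$,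 $w\prec u$ and $\mathbf{LM}(vw),\mathbf{LM}(vu)\notin K^*\cup\{0\}$, then $\mathbf{LM}(vw)\prec\mathbf{LM}(vu)$; and for $w,u\in\mathscr{B}$, if $u=\mathbf{LM}(vw)$ for some $v\in\mathscr{B}$ with $v\ne1$ (in case $1\in\mathscr{B}$), then $w\prec u$. Right monomial orderings are defined symmetrically. The pair $(\mathscr{B},\prec)$ is then called a (two-sided, left, right) admissible system. If $\Lambda$ is $\Gamma$-graded and $\mathscr{B}$ consists of homogeneous elements of degree $d(\cdot)$, a $\Gamma$-graded (left, right, two-sided) monomial ordering is a (left, right, two-sided) monomial ordering $\prec_{gr}$ given, from some well-ordering $\prec$ on $\mathscr{B}$, by $u\prec_{gr}v$ iff $d(u)<d(v)$, or $d(u)=d(v)$ and $u\prec v$. For $u,v\in\mathscr{B}$, $u\mid v$ means $v=\mathbf{LM}(wus)$ for some $w,s\in\mathscr{B}$ (in the left case $v=\mathbf{LM}(wu)$, in the right case $v=\mathbf{LM}(us)$). A (left, right, two-sided) Gröbner basis of a (left, right, two-sided) ideal $J$ is a generating set $\mathcal{G}$ of $J$ (of nonzero elements) such that for every nonzero $f\in J$ there is $g\in\mathcal{G}$ with $\mathbf{LM}(g)\mid\mathbf{LM}(f)$ (division in the corresponding sense). $\Lambda$ has a (left, right, two-sided) Gröbner basis theory with respect to $(\mathscr{B},\prec)$ if $(\mathscr{B},\prec)$ is a (left, right, two-sided) admissible system and every proper (left, right, two-sided) ideal has such a Gröbner basis. For $R$ itself, with skew multiplicative basis $\mathcal{B}$,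 having a two-sided Gröbner basis theory means having a two-sided admissible system $(\mathcal{B},\prec_{gr})$, and there $u\mid v$ means $v=\lambda wus$ for some $w,s\in\mathcal{B}$, $\lambda\in K^*$. For $0\neq f=r_{\gamma_1}+\cdots+r_{\gamma_s}\in R$ with $0\ne r_{\gamma_i}\in R_{\gamma_i}$, $\gamma_1<\cdots<\gamma_s$, put $d(f)=\gamma_s$ and $\mathbf{LH}(f)=r_{\gamma_s}$; $\mathbf{LH}(S)=\{\mathbf{LH}(f)\mid f\in S\}$. $A^\Gamma_{\rm LH}=R/\langle\mathbf{LH}(I)\rangle$ is the $\Gamma$-leading homogeneous algebra of $A$, with the $\Gamma$-gradation induced from $R$. $N(I)=\{u\in\mathcal{B}\mid\mathbf{LM}(f)\nmid u\text{ for all }0\neq f\in I\}$ (with respect to $\prec_{gr}$). For $u\in R$, $\bar u=u+I\in A$ and $\hat u=u+\langle\mathbf{LH}(I)\rangle\in A^\Gamma_{\rm LH}$; $\overline{N(I)}=\{\bar u\mid u\in N(I)\}$ and $\widehat{N(I)}=\{\hat u\mid u\in N(I)\}$, which are $K$-bases of $A$ and $A^\Gamma_{\rm LH}$ respectively. *)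

(* Defs.v *)
From HB Require Import structures.
From mathcomp Require Import all_boot all_order all_algebra.
From mathcomp Require Import boolp classical_sets.

Set Implicit Arguments.
Unset Strict Implicit.
Unset Printing Implicit Defensive.

Import Order.TTheory GRing.Theory.

Local Open Scope classical_set_scope.
Local Open Scope ring_scope.
Local Open Scope quotient_scope.

HB.mixin Record isOrderedSemigroup (d : Order.disp_t) G
    of Semigroup G & Order.Total d G := {
  ltgM2l : forall g g1 g2 : G, (g1 < g2)%O -> (g * g1 < g * g2)%O%g;
  ltgM2r : forall g g1 g2 : G, (g1 < g2)%O -> (g1 * g < g2 * g)%O%g
}.

#[short(type="orderedSemigroupType")]
HB.structure Definition OrderedSemigroup (d : Order.disp_t) :=
  {G of isOrderedSemigroup d G & Semigroup G & Order.Total d G}.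

Inductive side := LeftSided | RightSided | TwoSided.

Definition is_ideal (L : pzRingType) (sd : side) (J : set L) : Prop :=
  [/\ J 0,
      forall x y, J x -> J y -> J (x + y),
      sd <> RightSided -> forall a x, J x -> J (a * x) &
      sd <> LeftSided -> forall a x, J x -> J (x * a)].

Definition ideal_gen (L : pzRingType) (sd : side) (S : set L) : set L :=
  smallest (is_ideal sd) S.

Record properIdeal (L : pzRingType) := ProperIdeal {
  properIdeal_set :> set L;
  properIdeal_ideal : is_ideal TwoSided properIdeal_set;
  properIdeal_proper : properIdeal_set <> [set: L]
}.

(* The quotient of an algebra by a proper two-sided ideal; the library only
   provides quotients of commutative rings.  Properness is needed because an
   [algType] is nontrivial. *)
Module QuotientAlgebra.
Section QuotientAlgebra.
Variables (K : fieldType) (R : algType K) (I : properIdeal R).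
Local Notation J := (properIdeal_set I).

Let I0 : J 0. Proof. by case: (properIdeal_ideal I). Qed.
Let ID x y : J x -> J y -> J (x + y).
Proof. by case: (properIdeal_ideal I) => _ + _ _; apply. Qed.
Let IMl a x : J x -> J (a * x).
Proof. by case: (properIdeal_ideal I) => _ _ + _; apply. Qed.
Let IMr a x : J x -> J (x * a).
Proof. by case: (properIdeal_ideal I) => _ _ _; apply. Qed.
Let IN x : J x -> J (- x).
Proof. by rewrite -mulN1r; exact: IMl. Qed.

Definition equiv (x y : R) : bool := `[< J (x - y) >].

Lemma equiv_is_equiv : equiv_class_of equiv.
Proof.
split=> [x|x y|y x z].
- by apply/asboolP; rewrite subrr.
- by apply/asboolP/asboolP => /IN; rewrite opprB.
- move=> /asboolP xy /asboolP yz; apply/asboolP.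
  by rewrite -(subrKA y); exact: ID.
Qed.

Canonical equiv_equiv := EquivRelPack equiv_is_equiv.
Canonical equiv_encModRel := defaultEncModRel equiv.

Definition quot := {eq_quot equiv}.

#[export] HB.instance Definition _ : EqQuotient R equiv quot := EqQuotient.on quot.
#[export] HB.instance Definition _ := Choice.on quot.

Definition coset (x : R) : quot := \pi_quot x.

Lemma cosetE x y : coset x = coset y <-> J (x - y).
Proof.
split=> [|h]; first by move/eqquotP/asboolP.
by apply/eqquotP/asboolP.
Qed.

Lemma coset_surj (a : quot) : exists x, a = coset x.
Proof. by exists (repr a); rewrite /coset reprK. Qed.

Definition zero := coset 0.
Definition one := coset 1.
Definition opp (a : quot) := coset (- repr a).
Definition add (a b : quot) := coset (repr a + repr b).
Definition mul (a b : quot) := coset (repr a * repr b).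
Definition scale (k : K) (a : quot) := coset (k *: repr a).

Let reprI x : J (repr (coset x) - x).
Proof. by apply/cosetE; rewrite /coset reprK. Qed.

Let oppE x : opp (coset x) = coset (- x).
Proof. by apply/cosetE; rewrite -opprD; exact/IN/reprI. Qed.

Let addE x y : add (coset x) (coset y) = coset (x + y).
Proof. by apply/cosetE; rewrite opprD addrACA; apply: ID; exact: reprI. Qed.

Let mulE x y : mul (coset x) (coset y) = coset (x * y).
Proof.
apply/cosetE; rewrite -(subrKA (repr (coset x) * y)) -mulrBr -mulrBl.
by apply: ID; [apply/IMl/reprI | apply/IMr/reprI].
Qed.

Let scaleE k x : scale k (coset x) = coset (k *: x).
Proof. by apply/cosetE; rewrite -scalerBr -mulr_algl; exact/IMl/reprI. Qed.

Let addA : associative add.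
Proof.
move=> a b c; case: (coset_surj a) (coset_surj b) (coset_surj c).
by move=> x -> [y ->] [z ->]; rewrite !addE addrA.
Qed.
Let addC : commutative add.
Proof. by move=> a b; rewrite /add addrC. Qed.
Let add0 : left_id zero add.
Proof. by move=> a; case: (coset_surj a) => x ->; rewrite addE add0r. Qed.
Let addN : left_inverse zero opp add.
Proof.
by move=> a; case: (coset_surj a) => x ->; rewrite oppE addE addNr.
Qed.
#[export] HB.instance Definition _ := GRing.isZmodule.Build quot addA addC add0 addN.

Let mulA : associative mul.
Proof.
move=> a b c; case: (coset_surj a) (coset_surj b) (coset_surj c).
by move=> x -> [y ->] [z ->]; rewrite !mulE mulrA.
Qed.
Let mul1 : left_id one mul.
Proof. by move=> a; case: (coset_surj a) => x ->; rewrite mulE mul1r. Qed.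
Let mulx1 : right_id one mul.
Proof. by move=> a; case: (coset_surj a) => x ->; rewrite mulE mulr1. Qed.
Let mulDl : left_distributive mul add.
Proof.
move=> a b c; case: (coset_surj a) (coset_surj b) (coset_surj c).
by move=> x -> [y ->] [z ->]; rewrite !(addE, mulE) mulrDl.
Qed.
Let mulDr : right_distributive mul add.
Proof.
move=> a b c; case: (coset_surj a) (coset_surj b) (coset_surj c).
by move=> x -> [y ->] [z ->]; rewrite !(addE, mulE) mulrDr.
Qed.
Let one_neq0 : one != zero.
Proof.
apply/eqP => /cosetE; rewrite subr0 => J1.
apply: (@properIdeal_proper _ I); apply/seteqP; split=> x _ //=.
by rewrite -(mulr1 x); exact: IMl.
Qed.
#[export] HB.instance Definition _ := GRing.Zmodule_isNzRing.Build quot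
  mulA mul1 mulx1 mulDl mulDr one_neq0.

Let scaleA a b v : scale a (scale b v) = scale (a * b) v.
Proof. by case: (coset_surj v) => x ->; rewrite !scaleE scalerA. Qed.
Let scale1 : left_id 1 scale.
Proof. by move=> a; case: (coset_surj a) => x ->; rewrite scaleE scale1r. Qed.
Let scaleDr : right_distributive scale +%R.
Proof.
move=> k a b; case: (coset_surj a) (coset_surj b) => x -> [y ->].
by rewrite [_ + _]addE !scaleE [RHS]addE scalerDr.
Qed.
Let scaleDl v : {morph scale^~ v : a b / a + b}.
Proof.
by case: (coset_surj v) => x -> a b; rewrite !scaleE [RHS]addE scalerDl.
Qed.
#[export] HB.instance Definition _ := GRing.Zmodule_isLmodule.Build K quot
  scaleA scale1 scaleDr scaleDl.

Lemma cosetD x y : coset (x + y) = coset x + coset y.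
Proof. exact/esym/addE. Qed.
Lemma cosetM x y : coset (x * y) = coset x * coset y.
Proof. exact/esym/mulE. Qed.
Lemma cosetZ k x : coset (k *: x) = k *: coset x.
Proof. exact/esym/scaleE. Qed.

Let scaleAl (k : K) (a b : quot) : k *: (a * b) = (k *: a) * b.
Proof.
case: (coset_surj a) (coset_surj b) => x -> [y ->].
by rewrite -(cosetZ k x) -!cosetM -cosetZ scalerAl.
Qed.
#[export] HB.instance Definition _ := GRing.Lmodule_isLalgebra.Build K quot scaleAl.

Let scaleAr (k : K) (a b : quot) : k *: (a * b) = a * (k *: b).
Proof.
case: (coset_surj a) (coset_surj b) => x -> [y ->].
by rewrite -(cosetZ k y) -!cosetM -cosetZ scalerAr.
Qed.
#[export] HB.instance Definition _ := GRing.Lalgebra_isAlgebra.Build K quot scaleAr.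

Let coset_is_linear : linear coset.
Proof. by move=> k x y; rewrite cosetD cosetZ. Qed.
#[export] HB.instance Definition _ := GRing.isLinear.Build K R quot *:%R coset
  coset_is_linear.

Let coset_is_monoid_morphism : monoid_morphism coset.
Proof. by split=> [|x y]; [|exact: cosetM]. Qed.
#[export] HB.instance Definition _ := GRing.isMonoidMorphism.Build R quot coset
  coset_is_monoid_morphism.

End QuotientAlgebra.
Module Exports. HB.reexport. End Exports.
End QuotientAlgebra.
Export QuotientAlgebra.Exports.

Notation quot := QuotientAlgebra.quot.
Notation coset := QuotientAlgebra.coset.

Section Bases.
Variables (K : fieldType) (L : algType K).
Implicit Types (B : set L) (prec : L -> L -> Prop).

Definition is_basis B : Prop :=
  (forall f : L, exists (s : seq L) (c : L -> K),
     (forall u, u \in s -> B u) /\ f = \sum_(u <- s) c u *: u) /\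
  (forall (s : seq L) (c : L -> K), uniq s -> (forall u, u \in s -> B u) ->
     \sum_(u <- s) c u *: u = 0 -> forall u, u \in s -> c u = 0).

Definition well_order_on B prec : Prop :=
  [/\ forall u, B u -> ~ prec u u,
      forall u v w, B u -> B v -> B w -> prec u v -> prec v w -> prec u w,
      forall u v, B u -> B v -> [\/ prec u v, u = v | prec v u] &
      forall S : set L, S `<=` B -> S !=set0 ->
        exists2 u, S u & forall v, S v -> v <> u -> prec u v].

Definition leading_term B prec (f u : L) : Prop :=
  exists (s : seq L) (c : L -> K),
    [/\ uniq s, f = \sum_(v <- s) c v *: v,
        forall v, v \in s -> B v /\ c v != 0,
        u \in s & forall v, v \in s -> v <> u -> prec v u].

(* For a basis [B] well-ordered by [prec], a nonzero [f] has exactly one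
   leading term and 0 has none, so that [LM B prec 0 = 0]. *)
Definition LM B prec (f : L) : L := xget 0 [set u | leading_term B prec f u].

(* The pairs (v, s) by which one multiplies on both sides; the one-sided cases
   are the two-sided ones with 1 on the other side. *)
Definition multipliers (sd : side) B (v s : L) : Prop :=
  match sd with
  | LeftSided => B v /\ s = 1
  | RightSided => v = 1 /\ B s
  | TwoSided => B v /\ B s
  end.

(* Membership in K^* or {0}. *)
Definition is_scalar (x : L) : Prop := exists k : K, x = k%:A.

Record monomial_ordering (sd : side) B prec : Prop := MonomialOrdering {
  mo_well_order : well_order_on B prec;
  mo_mul : forall w u v s, B w -> B u -> multipliers sd B v s -> prec w u ->
    ~ is_scalar (LM B prec (v * w * s)) ->
    ~ is_scalar (LM B prec (v * u * s)) ->
    prec (LM B prec (v * w * s)) (LM B prec (v * u * s));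
  mo_dvd : forall w u v s, B w -> B u -> multipliers sd B v s ->
    v <> 1 \/ s <> 1 -> u = LM B prec (v * w * s) -> prec w u
}.

Definition admissible_system (sd : side) B prec : Prop :=
  is_basis B /\ monomial_ordering sd B prec.

Definition divides (sd : side) B prec (u v : L) : Prop :=
  exists w s, multipliers sd B w s /\ v = LM B prec (w * u * s).

Definition groebner_basis (sd : side) B prec (J G : set L) : Prop :=
  [/\ forall g, G g -> g <> 0,
      ideal_gen sd G = J &
      forall f, J f -> f <> 0 ->
        exists2 g, G g & divides sd B prec (LM B prec g) (LM B prec f)].

Definition groebner_theory (sd : side) B prec : Prop :=
  admissible_system sd B prec /\
  forall J, is_ideal sd J -> J <> [set: L] ->
    exists G, groebner_basis sd B prec J G.

Definition generates (gens : seq L) : Prop :=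
  forall S : {pred L}, GRing.subalg_closed S -> {subset gens <= S} ->
    forall x, x \in S.

(* A product of powers of the generators is encoded by the list of its
   factors x ^+ n, given as pairs (x, n). *)
Record skew_multiplicative_basis (gens : seq L) B : Prop :=
  SkewMultiplicativeBasis {
    smb_basis : is_basis B;
    smb_gens : forall b, B b -> exists p : seq (L * nat),
      (forall x, x \in p -> x.1 \in gens) /\ b = \prod_(x <- p) x.1 ^+ x.2;
    smb_mul : forall u v, B u -> B v ->
      u * v = 0 \/ exists k w, [/\ k != 0, B w & u * v = k *: w]
  }.

Definition skew_divides B (u v : L) : Prop :=
  exists w s (k : K), [/\ B w, B s, k != 0 & v = k *: (w * u * s)].

Definition normal_monomials B prec (I : set L) : set L :=
  [set u | B u /\ forall f, I f -> f <> 0 -> ~ skew_divides B (LM B prec f) u].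

End Bases.

Section Gradings.
Variables (d : Order.disp_t) (Gam : orderedSemigroupType d).
Variables (K : fieldType) (L : algType K).
Implicit Types (Lg : Gam -> set L).

Record grading Lg : Prop := Grading {
  grading0 : forall g, Lg g 0;
  gradingZD : forall g k x y, Lg g x -> Lg g y -> Lg g (k *: x + y);
  gradingM : forall g h x y, Lg g x -> Lg h y -> Lg (g * h)%g (x * y);
  grading_sum : forall f, exists (s : seq Gam) (c : Gam -> L),
    [/\ uniq s, forall g, g \in s -> Lg g (c g) & f = \sum_(g <- s) c g];
  grading_direct : forall (s : seq Gam) (c : Gam -> L),
    uniq s -> (forall g, g \in s -> Lg g (c g)) ->
    \sum_(g <- s) c g = 0 -> forall g, g \in s -> c g = 0
}.

Definition homogeneous Lg (f : L) : Prop := exists g, Lg g f.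

(* [f] has degree [g] and leading homogeneous part [r]. *)
Definition leading_part Lg (f : L) (g : Gam) (r : L) : Prop :=
  exists (s : seq Gam) (c : Gam -> L),
    [/\ uniq s, f = \sum_(h <- s) c h,
        forall h, h \in s -> Lg h (c h) /\ c h <> 0,
        g \in s /\ (forall h, h \in s -> (h <= g)%O) & r = c g].

Definition has_degree Lg (f : L) (g : Gam) : Prop :=
  exists r, leading_part Lg f g r.

(* [LH Lg 0 = 0]: including it in [LH Lg @` I] does not change the ideal
   generated. *)
Definition LH Lg (f : L) : L := xget 0 [set r | exists g, leading_part Lg f g r].

Record graded_monomial_ordering (sd : side) Lg (B : set L)
    (prec : L -> L -> Prop) : Prop := GradedMonomialOrdering {
  gmo_homogeneous : forall u, B u -> homogeneous Lg u;
  gmo_admissible : admissible_system sd B prec;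
  gmo_graded : exists prec0, well_order_on B prec0 /\
    forall u v, B u -> B v ->
      (prec u v <-> exists g h, [/\ has_degree Lg u g, has_degree Lg v h &
                                   (g < h)%O \/ g = h /\ prec0 u v])
}.

Definition graded_ideal Lg (sd : side) (J : set L) : Prop :=
  is_ideal sd J /\
  forall f, J f -> exists s : seq L,
    (forall x, x \in s -> J x /\ homogeneous Lg x) /\ f = \sum_(x <- s) x.

End Gradings.

Definition is_domain (L : nzRingType) : Prop :=
  forall x y : L, x * y = 0 -> x = 0 \/ y = 0.

Definition quot_grading (d : Order.disp_t) (Gam : orderedSemigroupType d)
    (K : fieldType) (L : algType K) (I : properIdeal L) (Lg : Gam -> set L) :
    Gam -> set (quot I) :=
  fun g => @coset K L I @` Lg g.
Arguments quot_grading [d Gam K L] I Lg g _.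

(* The order on the classes mod [I] of [N] induced by an order on the classes
   mod [I'] of [N]. *)
Definition transfer_order (K : fieldType) (L : algType K)
    (I I' : properIdeal L) (N : set L) (prec : quot I' -> quot I' -> Prop) :
    quot I -> quot I -> Prop :=
  fun x y => exists u v,
    [/\ N u, N v, x = coset I u, y = coset I v & prec (coset I' u) (coset I' v)].
Arguments transfer_order [K L] I [I'] N prec _ _.

(* Main.v *)
Require Import Defs.
From HB Require Import structures.
From mathcomp Require Import all_boot all_order all_algebra.
From mathcomp Require Import boolp classical_sets.

Set Implicit Arguments.
Unset Strict Implicit.
Unset Printing Implicit Defensive.

Local Open Scope classical_set_scope.
Local Open Scope ring_scope.

Import Order.TTheory GRing.Theory.

(* Filter A = R/I by degree.  The components of <LH(I)> are exactly the leading
   components of elements of I, so gr(A) is isomorphic to A_LH; write sigma(x)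
   for the symbol of x.  As A_LH is a domain, sigma(xy) = sigma(x) sigma(y).
   Normal words have the same images in both algebras, and since the order on
   A_LH is graded, LM(sigma(x)) and LM(x) are the classes of the same normal
   word; hence the axioms of a monomial ordering pass from A_LH to A.  For an
   ideal J of A, the symbols of J span a graded ideal; each element of a
   homogeneous Groebner basis of it is the symbol of some x in J, and these x
   form a Groebner basis of J. *)

(** A product of classes of normal words is in general a long combination of normal words, and a
    different one in each quotient; what the two share is the top symbol. The axioms therefore pass
    from one algebra to the other once the product of symbols is known not to vanish, which is what
    the domain hypothesis gives. The relation [symbol g x a] admits any bound [g] on the degree and
    allows [a = 0], so that it is closed under sums and products without case distinctions on
    cancellation. The first axiom is silent about scalar leading monomials; the monomial 1 thus
    needs its own treatment: it lies in the basis, is its least element, and is a normal word. *)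

(** * Direct sum decompositions and their components *)

Section Decomposition.
Variables (K : fieldType) (V : lmodType K) (T : eqType).

(** Used with [T] the grading semigroup, and with [T] the algebra itself for the lines spanned by
    basis vectors. *)
Record decomposition (P : T -> set V) : Prop := Decomposition {
  dec0 : forall t, P t 0;
  decZD : forall t k x y, P t x -> P t y -> P t (k *: x + y);
  dec_sum : forall f, exists (s : seq T) (c : T -> V),
    [/\ uniq s, forall t, t \in s -> P t (c t) & f = \sum_(t <- s) c t];
  dec_direct : forall (s : seq T) (c : T -> V),
    uniq s -> (forall t, t \in s -> P t (c t)) ->
    \sum_(t <- s) c t = 0 -> forall t, t \in s -> c t = 0
}.

(** Finite presentations of [f] are not unique, since zero components may be listed or omitted;
    [partE] shows that every presentation yields the same value. *)
Definition part (P : T -> set V) (t : T) (f : V) : V :=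
  xget 0 [set x | exists (s : seq T) (c : T -> V),
    [/\ uniq s, forall t, t \in s -> P t (c t), f = \sum_(t <- s) c t &
        x = if t \in s then c t else 0]].

Lemma big_sub_uniq (s s' : seq T) (c : T -> V) :
  uniq s -> uniq s' -> {subset s <= s'} ->
  \sum_(t <- s') (if t \in s then c t else 0) = \sum_(t <- s) c t.
Proof.
move=> us us' ss'; rewrite -big_mkcond -big_filter; apply: perm_big.
apply: uniq_perm => //; first exact: filter_uniq.
by move=> t; rewrite mem_filter; case: (boolP (t \in s)) => //= /ss'.
Qed.

Variable P : T -> set V.
Hypothesis decP : decomposition P.

Let P0 t : P t 0. Proof. exact: dec0. Qed.
Let PN t x : P t x -> P t (- x).
Proof. by move=> Px; rewrite -[- x]addr0 -scaleN1r; exact: decZD. Qed.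
Let PD t x y : P t x -> P t y -> P t (x + y).
Proof. by move=> Px Py; rewrite -[x]scale1r; exact: decZD. Qed.

(** Two presentations, padded with zeros to a common index list, have a difference summing to 0, and
    directness kills each of its terms. *)
Lemma partE (s : seq T) (c : T -> V) (t : T) :
  uniq s -> (forall t, t \in s -> P t (c t)) ->
  part P t (\sum_(t <- s) c t) = if t \in s then c t else 0.
Proof.
move=> us sP; rewrite /part.
have : [set x | exists (s0 : seq T) (c0 : T -> V),
    [/\ uniq s0, forall t, t \in s0 -> P t (c0 t),
      \sum_(t <- s) c t = \sum_(t <- s0) c0 t &
      x = if t \in s0 then c0 t else 0]] (if t \in s then c t else 0).
  by exists s, c.
move=> /(xgetI 0) [s' [c' [us' sP' E ->]]].
pose S := undup (s ++ s').
have uS : uniq S by exact: undup_uniq.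
pose dd t := (if t \in s then c t else 0) - (if t \in s' then c' t else 0).
have dP u : u \in S -> P u (dd u).
  by move=> _; rewrite /dd; apply: PD; [|apply: PN];
    case: ifP => // /[dup] us0 ?; [exact: sP | exact: sP'].
have d0 : \sum_(t <- S) dd t = 0.
  rewrite sumrB !big_sub_uniq // ?E ?subrr // => u;
  by rewrite mem_undup mem_cat => ->; rewrite ?orbT.
have /(_ t) dt := dec_direct decP uS dP d0.
have [tS|] := boolP (t \in S); first by move/eqP: (dt tS); rewrite subr_eq0 => /eqP.
by rewrite mem_undup mem_cat negb_or => /andP[/negPf -> /negPf ->].
Qed.

Lemma part_in t f : P t (part P t f).
Proof.
have [s [c [us sP ->]]] := dec_sum decP f; rewrite partE //.
by case: ifP => // /sP.
Qed.

Lemma part_id t x : P t x -> part P t x = x.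
Proof.
move=> Px; have := @partE [:: t] (fun=> x) t isT.
rewrite big_seq1 mem_head; apply=> u; by rewrite inE => /eqP ->.
Qed.

Lemma part_neq t u x : P t x -> u != t -> part P u x = 0.
Proof.
move=> Px ut; have := @partE [:: t] (fun=> x) u isT.
rewrite big_seq1 inE (negPf ut); apply=> v; by rewrite inE => /eqP ->.
Qed.

Lemma part_lin t k x y : part P t (k *: x + y) = k *: part P t x + part P t y.
Proof.
have [s [c [us sP ->]]] := dec_sum decP x.
have [s' [c' [us' sP' ->]]] := dec_sum decP y.
pose S := undup (s ++ s').
have uS : uniq S by exact: undup_uniq.
pose dd t := k *: (if t \in s then c t else 0) + (if t \in s' then c' t else 0).
have dP u : u \in S -> P u (dd u).
  move=> _; rewrite /dd; apply: decZD => //; case: ifP => // h;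
  [exact: sP | exact: sP'].
have -> : k *: \sum_(t <- s) c t + \sum_(t <- s') c' t = \sum_(t <- S) dd t.
  rewrite big_split /= -scaler_sumr !big_sub_uniq // => u;
  by rewrite mem_undup mem_cat => ->; rewrite ?orbT.
rewrite !partE // /dd; case: ifP => //.
rewrite mem_undup mem_cat => /negbT.
by rewrite negb_or => /andP[/negPf -> /negPf ->]; rewrite scaler0 addr0.
Qed.

Lemma part0 t : part P t 0 = 0. Proof. exact: part_id. Qed.

Lemma partD t x y : part P t (x + y) = part P t x + part P t y.
Proof. by rewrite -[x]scale1r part_lin !scale1r. Qed.

Lemma partZ t k x : part P t (k *: x) = k *: part P t x.
Proof. by rewrite -[k *: x]addr0 part_lin part0 addr0. Qed.

Lemma partB t x y : part P t (x - y) = part P t x - part P t y.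
Proof. by rewrite partD -scaleN1r partZ scaleN1r. Qed.

Lemma part_supp f : exists s : seq T,
  [/\ uniq s, forall t, (t \in s) = (part P t f != 0) &
      f = \sum_(t <- s) part P t f].
Proof.
have [s [c [us sP fE]]] := dec_sum decP f.
have pE t : part P t f = if t \in s then c t else 0 by rewrite fE partE.
exists [seq t <- s | part P t f != 0]; split; first exact: filter_uniq.
  move=> t; rewrite mem_filter andbC; case: (boolP (t \in s)) => //= /negPf ts.
  by rewrite pE ts eqxx.
rewrite big_filter big_mkcond {1}fE; apply: eq_big_seq => t ts.
by case: eqP => /=; rewrite pE ts.
Qed.

(** Only components of the given [f] are tested, so what is known about [f] can be used on each of
    them. *)
Lemma part_ind (Q : V -> Prop) f : Q 0 -> (forall x y, Q x -> Q y -> Q (x + y)) ->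
  (forall t, Q (part P t f)) -> Q f.
Proof.
move=> Q0 QD Qf; have [s [_ _ ->]] := part_supp f.
by elim/big_ind: _.
Qed.

Lemma part_eq0 f : (forall t, part P t f = 0) -> f = 0.
Proof.
by move=> f0; apply: (@part_ind (fun x => x = 0) f) => // x y -> ->; rewrite addr0.
Qed.

Lemma part_neq0 f : f <> 0 -> exists t, part P t f <> 0.
Proof.
by move=> f0; apply/existsNP => h; apply: f0; exact: part_eq0.
Qed.

End Decomposition.

(** * Leading monomials *)

Section Bases.
Variables (K : fieldType) (L : algType K) (B : set L).

(* The span of [u] when [B u], and 0 otherwise, so that a basis decomposes [L]
   into lines indexed by all of [L]. *)
Definition line (u : L) : set L := [set x | exists2 k : K, x = k *: u & B u \/ x = 0].

Lemma line_mem u k : B u -> line u (k *: u).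
Proof. by move=> Bu; exists k => //; left. Qed.

Lemma line_id u : B u -> line u u.
Proof. by move=> Bu; rewrite -{2}[u]scale1r; exact: line_mem. Qed.

Hypothesis B_basis : is_basis B.

Lemma basis_decomposition : decomposition line.
Proof.
have [span indep] := B_basis; split.
- by move=> u; exists 0; [rewrite scale0r | right].
- move=> u k x y [a xE [Bu|x0]] [b yE [Bu'|y0]].
  + by exists (k * a + b); [rewrite xE yE scalerDl scalerA | left].
  + by exists (k * a); [rewrite y0 addr0 xE scalerA | left].
  + by exists b; [rewrite x0 scaler0 add0r | left].
  + by exists 0; [rewrite x0 y0 scaler0 scale0r addr0 | right; rewrite x0 y0 scaler0 addr0].
- move=> f; have [s [c [sB ->]]] := span f.
  (* The list [s] may repeat a basis vector; its coefficient is counted with multiplicity. *)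
  exists (undup s), (fun u => (c u *: u) *+ count_mem u s); split.
  + exact: undup_uniq.
  + move=> u; rewrite mem_undup => /sB Bu.
    by exists (c u *+ count_mem u s); [rewrite scalerMnl | left].
  + by rewrite -(big_undup_iterop_count _ _ xpredT).
- move=> s c us cl c0.
  have /choice [k kP] : forall u, exists k : K, u \in s -> c u = k *: u /\ (B u \/ c u = 0).
    move=> u; have [us'|] := boolP (u \in s); last by exists 0.
    by have [k cE h] := cl u us'; exists k.
  (* Indices outside [B] carry the zero vector, so independence is applied to the indices in [B]. *)
  pose s' := [seq u <- s | `[< B u >]].
  have uE : \sum_(u <- s') k u *: u = 0.
    rewrite big_filter big_mkcond -[RHS]c0; apply: eq_big_seq => u us0 /=.
    have [cE h] := kP u us0; rewrite cE; case: asboolP => // nB.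
    by case: h => [//|h]; rewrite -cE h.
  have s'B u : u \in s' -> B u by rewrite mem_filter => /andP[/asboolP].
  have z := indep s' k (filter_uniq _ us) s'B uE.
  move=> u us0; have [cE [Bu|//]] := kP u us0.
  by rewrite cE z ?scale0r // mem_filter us0 andbT; apply/asboolP.
Qed.
Let decB := basis_decomposition.

Lemma basis_neq0 u : B u -> u <> 0.
Proof.
move=> Bu u0; have := B_basis.2 [:: u] (fun=> 1) isT.
have /[swap]/[apply] : forall v, v \in [:: u] -> B v by move=> v; rewrite inE => /eqP ->.
rewrite big_seq1 u0 scaler0 => /(_ erefl 0); rewrite mem_head => /(_ isT) /eqP.
by rewrite oner_eq0.
Qed.

Lemma part_lineE u f : exists2 k : K, part line u f = k *: u & k != 0 <-> part line u f <> 0.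
Proof.
have [k kE [Bu|h]] := part_in decB u f.
  exists k => //; rewrite kE; split=> [k0 /eqP|h].
    by rewrite scaler_eq0 (negPf k0) => /eqP; exact: basis_neq0.
  by apply/eqP => k0; apply: h; rewrite k0 scale0r.
exists 0; first by rewrite h scale0r.
by rewrite eqxx h; split.
Qed.

Lemma part_line_mem u f : part line u f <> 0 -> B u.
Proof. by have [k kE [Bu|h]] := part_in decB u f. Qed.

Lemma part_line_basis u v : B v -> part line u v <> 0 -> u = v.
Proof.
move=> Bv; have [//|uv] := eqVneq u v.
by rewrite (part_neq decB (line_id Bv) uv).
Qed.

Lemma basis_scalar : B 1 -> forall u, B u -> is_scalar u -> u = 1.
Proof.
move=> B1 u Bu [k uE]; have [//|u1] := eqVneq u 1.
have := part_neq decB (line_mem k B1) u1; rewrite -uE (part_id decB (line_id Bu)).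
by move/basis_neq0 => /(_ Bu).
Qed.

Variable prec : L -> L -> Prop.

Lemma leading_termP f u : leading_term B prec f u <->
  part line u f <> 0 /\ forall v, part line v f <> 0 -> v <> u -> prec v u.
Proof.
split.
- move=> [s [c [us fE sP us0 sm]]].
  have sl v : v \in s -> line v (c v *: v) by move=> /sP[Bv _]; exact: line_mem.
  have pE v : part line v f = if v \in s then c v *: v else 0 by rewrite fE partE.
  split; first rewrite pE us0.
    have [Bu cu] := sP _ us0; move/eqP; rewrite scaler_eq0 (negPf cu) => /eqP.
    exact: basis_neq0.
  by move=> v; rewrite pE; case: ifP => // vs _; exact: sm.
- move=> [u0 um]; have [s [us sE fE]] := part_supp decB f.
  have /choice [k kP] : forall u, exists k : K,
      part line u f = k *: u /\ (k != 0 <-> part line u f <> 0).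
    by move=> v; have [k ? ?] := part_lineE v f; exists k.
  exists s, k; split => //.
  + by rewrite {1}fE; apply: eq_bigr => v _; case: (kP v).
  + move=> v; rewrite sE => /eqP h; split; first exact: part_line_mem h.
    exact/(kP v).2.
  + by rewrite sE; apply/eqP.
  + by move=> v; rewrite sE => /eqP; exact: um.
Qed.

Hypothesis woB : well_order_on B prec.

Lemma leading_term_uniq f u v :
  leading_term B prec f u -> leading_term B prec f v -> u = v.
Proof.
move=> /leading_termP[u0 um] /leading_termP[v0 vm].
have [irr tr _ _] := woB; have [//|/eqP uv] := eqVneq u v.
have Bu := part_line_mem u0; have Bv := part_line_mem v0.
by case: (irr u Bu); apply: (tr _ v) => //; [exact: vm | apply: um => // /esym].
Qed.

Lemma leading_termE f u : leading_term B prec f u -> LM B prec f = u.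
Proof.
move=> h; apply: xget_unique => // v hv; exact: leading_term_uniq hv h.
Qed.

Lemma finite_max (s : seq L) : s != [::] -> (forall u, u \in s -> B u) ->
  exists2 m, m \in s & forall v, v \in s -> v <> m -> prec v m.
Proof.
have [irr tr tot _] := woB.
elim: s => // a [|b s] IH _ sB.
  by exists a; rewrite ?mem_head // => v; rewrite inE => /eqP.
have sB' u : u \in b :: s -> B u by move=> us; apply: sB; rewrite inE us orbT.
have [//|//|m ms mm] := IH.
have Ba : B a by apply: sB; rewrite mem_head.
have Bm := sB' _ ms.
have am v : v \in a :: b :: s -> prec m a -> v <> a -> prec v a.
  rewrite inE => /orP[/eqP //|vs] ma _; have [->//|/eqP vm] := eqVneq v m.
  by apply: (tr _ m) => //; [exact: sB' | exact: mm].
case: (tot a m) => // [pam|->|pma].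
- exists m; first by rewrite inE ms orbT.
  by move=> v; rewrite inE => /orP[/eqP -> //|]; exact: mm.
- exists m; first by rewrite inE eqxx.
  by move=> v; rewrite inE => /orP[/eqP -> //|]; exact: mm.
- by exists a; [rewrite mem_head | move=> v /am; exact].
Qed.

Lemma LM_leading f : f <> 0 -> leading_term B prec f (LM B prec f).
Proof.
move=> f0; suff [u hu] : exists u, leading_term B prec f u by rewrite (leading_termE hu).
have [s [_ sE _]] := part_supp decB f.
have [||m ms mm] := @finite_max s.
- apply/eqP => s0; apply: f0; apply: (part_eq0 decB) => t.
  by apply/eqP; have := sE t; rewrite s0 in_nil => /esym/negbFE.
- by move=> u; rewrite sE => /eqP; exact: part_line_mem.
exists m; apply/leading_termP; split; first by apply/eqP; rewrite -sE.
by move=> v /eqP; rewrite -sE; exact: mm.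
Qed.

Lemma LM_mem f : f <> 0 -> B (LM B prec f).
Proof. by move=> /LM_leading/leading_termP[/part_line_mem]. Qed.

Lemma LM0 : LM B prec 0 = 0.
Proof.
apply: xgetPN => u /leading_termP[]; by rewrite (part0 decB).
Qed.

Lemma LM_neq0 f : LM B prec f <> 0 -> f <> 0.
Proof. by move=> + f0; rewrite f0 LM0. Qed.

Lemma LM_scale k u : B u -> k != 0 -> LM B prec (k *: u) = u.
Proof.
move=> Bu k0; apply: leading_termE; apply/leading_termP.
rewrite !(part_id decB (line_mem k Bu)); split.
  by move/eqP; rewrite scaler_eq0 (negPf k0) => /eqP; exact: basis_neq0.
by move=> v + /eqP vu; rewrite (part_neq decB (line_mem k Bu) vu).
Qed.

Lemma LM_id u : B u -> LM B prec u = u.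
Proof. by move=> Bu; rewrite -{1}[u]scale1r LM_scale ?oner_eq0. Qed.

(** Well-founded induction along leading monomials, by a least leading monomial of a counterexample.
    The case of 0 is separate because it has no leading monomial in [B]. *)
Lemma LM_ind (Q : L -> Prop) : Q 0 ->
  (forall f, f <> 0 -> (forall f', f' = 0 \/ prec (LM B prec f') (LM B prec f) -> Q f') ->
     Q f) -> forall f, Q f.
Proof.
have [irr tr _ wf] := woB; move=> Q0 IH f; apply: contrapT => nQ.
pose S := [set u | exists f, [/\ f <> 0, ~ Q f & u = LM B prec f]].
have SB : S `<=` B by move=> u [g [g0 _ ->]]; exact: LM_mem.
have nz g : ~ Q g -> g <> 0 by move=> h g0; apply: h; rewrite g0.
have [|_ [g [g0 nQg ->]] gm] := wf S SB.
  by exists (LM B prec f); exists f; split => //; exact: nz.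
apply: nQg; apply: IH => // g' [-> //|pg]; apply: contrapT => nQ'.
have g'0 := nz _ nQ'.
have Bg := LM_mem g0; have Bg' := LM_mem g'0.
have [E|/eqP E] := eqVneq (LM B prec g') (LM B prec g).
  by apply: (irr _ Bg); rewrite -{1}E.
have := gm (LM B prec g') => /(_ _ E) h.
by apply: (irr _ Bg); apply: (tr _ (LM B prec g')) => //; apply: h; exists g'.
Qed.

(** The scalar is the quotient of the two leading coefficients. Any monomial left in the difference
    comes from [f] or [h] and is not their common leading one, so it lies below. *)
Lemma LM_cancel f h : f <> 0 -> h <> 0 -> LM B prec f = LM B prec h ->
  exists k : K, f - k *: h = 0 \/ prec (LM B prec (f - k *: h)) (LM B prec f).
Proof.
move=> f0 h0 E.
have /leading_termP[fm fM] := LM_leading f0.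
have /leading_termP[hm hM] := LM_leading h0.
rewrite -E in hm hM; set m := LM B prec f in fm fM hm hM *.
have [a aE _] := part_lineE m f; have [b bE b0] := part_lineE m h.
have {}b0 := b0.2 hm.
exists (a / b); set f' := f - _.
have [->|/eqP f'0] := eqVneq f' 0; [by left | right].
have /leading_termP[+ _] := LM_leading f'0.
set m' := LM B prec f'; rewrite /f' (partB decB) (partZ decB) => m'0.
have m'm : m' <> m.
  by move=> mm; apply: m'0; rewrite mm aE bE scalerA divfK // subrr.
have [p0|/eqP p0] := eqVneq (part line m' f) 0; last exact: fM.
apply: hM => // p0'; apply: m'0; by rewrite p0 p0' scaler0 subrr.
Qed.

End Bases.

(** * Multiplication and division of leading terms *)

Section MonomialOrderings.
Variables (K : fieldType) (L : algType K) (B : set L) (prec : L -> L -> Prop).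
Variable sd : side.
Hypotheses (B_basis : is_basis B) (mo : monomial_ordering sd B prec) (B1 : B 1).
Let decB := basis_decomposition B_basis.
Let wo := mo_well_order mo.

(** On whichever side multipliers are allowed, [u] is the product of 1 with the multiplier [u], so
    the second axiom applies. *)
Lemma one_min u : B u -> u <> 1 -> prec 1 u.
Proof.
move=> Bu u1; have LMu := LM_id B_basis wo Bu.
case: (sd) mo => mo'.
- by apply: (mo_dvd mo' B1 Bu (v := u) (s := 1)) => //; [left | rewrite !mulr1].
- by apply: (mo_dvd mo' B1 Bu (v := 1) (s := u)) => //; [right | rewrite !mul1r].
- by apply: (mo_dvd mo' B1 Bu (v := u) (s := 1)) => //; [left | rewrite !mulr1].
Qed.

(** Split [g] into its leading term and terms at lower [v], and let [M] be the leading monomial of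
    [w * LM B prec g * s]. The first axiom puts [LM B prec (w * v * s)] below [M] unless one of the
    two is scalar: the former may be 1, which is below [M] anyway as the least monomial, and [M]
    itself is not 1. *)
Lemma LM_mul g w s : g <> 0 -> multipliers sd B w s ->
  w * LM B prec g * s <> 0 ->
  leading_term B prec (w * g * s) (LM B prec (w * LM B prec g * s)).
Proof.
move=> g0 ws; set m := LM B prec g => wms0.
have Bm : B m by exact: LM_mem.
have [irr tr tot _] := wo.
(* Trivial multipliers are set aside, as the second axiom requires one of them to differ from 1. *)
have [[w1 s1]|ws1] := pselect (w = 1 /\ s = 1).
  by rewrite w1 s1 !mul1r !mulr1 (LM_id B_basis wo Bm); exact: LM_leading.
have {}ws1 : w <> 1 \/ s <> 1.
  by have [w1|/eqP] := eqVneq w 1; [right => s1; apply: ws1 | left].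
have BM : B (LM B prec (w * m * s)) by exact: LM_mem.
set M := LM B prec (w * m * s) in BM *.
(* Otherwise the second axiom would put [m] below 1, the least monomial. *)
have M1 : M <> 1.
  move=> M1; have := mo_dvd mo Bm B1 ws ws1 (esym M1).
  have [->|/eqP m1 pm1] := eqVneq m 1; first exact: irr.
  by apply: (irr 1 B1); apply: (tr _ m) => //; exact: one_min.
have /(leading_termP B_basis)[Mm MM] := LM_leading B_basis wo wms0.
rewrite -/M in Mm MM.
have nsM : ~ is_scalar M by move/(basis_scalar B_basis B1 BM).
have /(leading_termP B_basis)[gm gM] := LM_leading B_basis wo g0.
rewrite -/m in gm gM.
have lower v : B v -> prec v m -> forall b, part (line B) b (w * v * s) <> 0 -> prec b M.
  move=> Bv vm b b0.
  have y0 : w * v * s <> 0 by move=> y0; rewrite y0 (part0 decB) in b0.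
  have /(leading_termP B_basis)[_ yM] := LM_leading B_basis wo y0.
  have Bb0 := LM_mem B_basis wo y0.
  have b0M : prec (LM B prec (w * v * s)) M.
    have [->|/eqP b01] := eqVneq (LM B prec (w * v * s)) 1; first exact: one_min.
    by apply: (mo_mul mo) => // /(basis_scalar B_basis B1 Bb0).
  have [->//|/eqP bb] := eqVneq b (LM B prec (w * v * s)).
  apply: (tr _ (LM B prec (w * v * s))) => //; first exact: part_line_mem b0.
  exact: yM.
pose g' := g - part (line B) m g.
have g'lower b : part (line B) b (w * g' * s) <> 0 -> prec b M.
  have : forall t, part (line B) t g' = 0 \/ (B t /\ prec t m).
    move=> t; have [?|/eqP t0] := eqVneq (part (line B) t g') 0; [by left | right].
    have Bt := part_line_mem B_basis t0.
    split => //; apply: gM.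
      move=> tg; apply: t0; rewrite /g' (partB decB) tg.
      have [tm|tm] := eqVneq t m; first by rewrite -tm tg (part0 decB) subrr.
      by rewrite (part_neq decB (part_in decB m g) tm) subrr.
    move=> tm; apply: t0.
    by rewrite tm /g' (partB decB) (part_id decB (part_in decB m g)) subrr.
  move=> g't; move: b.
  pose Q x := forall b, part (line B) b (w * x * s) <> 0 -> prec b M.
  apply: (part_ind decB (Q := Q)); rewrite {}/Q.
  - by move=> b; rewrite mulr0 mul0r (part0 decB).
  - move=> x y IHx IHy b; rewrite mulrDr mulrDl (partD decB) => h.
    have [x0|/eqP x0] := eqVneq (part (line B) b (w * x * s)) 0; last exact: IHx.
    by apply: IHy => y0; apply: h; rewrite x0 y0 addr0.
  - move=> t b; have [->|[Bt tm]] := g't t; first by rewrite mulr0 mul0r (part0 decB).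
    have [k -> _] := part_lineE B_basis t g'.
    rewrite -scalerAr -scalerAl (partZ decB) => h; apply: (lower t) => // h0.
    by apply: h; rewrite h0 scaler0.
have [k kE k0] := part_lineE B_basis m g.
have gE : w * g * s = k *: (w * m * s) + w * g' * s.
  by rewrite scalerAl scalerAr -kE -mulrDl -mulrDr /g' addrC subrK.
apply/(leading_termP B_basis); rewrite gE; split.
- rewrite (partD decB) (partZ decB).
  have [->|/eqP h] := eqVneq (part (line B) M (w * g' * s)) 0; last first.
    by case: (irr _ BM); exact: g'lower.
  rewrite addr0 => /eqP; rewrite scaler_eq0 => /orP[k0'|/eqP //].
  by move: (k0.2 gm); rewrite k0'.
- move=> v; rewrite (partD decB) (partZ decB) => h vM.
  have [h'|/eqP h'] := eqVneq (part (line B) v (w * g' * s)) 0; last exact: g'lower.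
  by apply: MM => // v0; apply: h; rewrite h' v0 scaler0 addr0.
Qed.

(** [w * LM B prec g * s] is nonzero because its leading monomial lies in the basis, so [LM_mul]
    applies and [w * g * s] has the same leading monomial as [f]. *)
Lemma LM_reduce f g w s : f <> 0 -> g <> 0 -> multipliers sd B w s ->
  LM B prec f = LM B prec (w * LM B prec g * s) ->
  exists k : K, f - k *: (w * g * s) = 0 \/
    prec (LM B prec (f - k *: (w * g * s))) (LM B prec f).
Proof.
move=> f0 g0 ws E.
have wms0 : w * LM B prec g * s <> 0.
  apply: (LM_neq0 B_basis (prec := prec)); rewrite -E.
  by apply: (basis_neq0 B_basis); exact: LM_mem.
have lt := LM_mul g0 ws wms0.
apply: LM_cancel => //; last by rewrite (leading_termE B_basis wo lt).
move=> h0; move/(leading_termP B_basis): lt => []; rewrite h0 => + _.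
by rewrite (part0 decB).
Qed.

End MonomialOrderings.

(** * One-sided and two-sided ideals *)

Section Ideals.
Variables (K : fieldType) (L : algType K) (sd : side).
Implicit Type J : set L.

(** A scalar is multiplied in as [k%:A], on whichever side the ideal allows. *)
Lemma is_ideal_scale J k x : is_ideal sd J -> J x -> J (k *: x).
Proof.
case=> _ _ Jl Jr Jx; case: (sd) Jl Jr => Jl Jr.
- by rewrite -mulr_algl; exact: Jl.
- by rewrite -mulr_algr; exact: Jr.
- by rewrite -mulr_algl; exact: Jl.
Qed.

Lemma is_ideal_sub J x y : is_ideal sd J -> J x -> J y -> J (x - y).
Proof.
move=> iJ Jx Jy; rewrite -scaleN1r; have [_ JD _ _] := iJ.
by apply: JD => //; exact: is_ideal_scale.
Qed.

Lemma is_ideal_mul J (B : set L) w s x : is_ideal sd J ->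
  multipliers sd B w s -> J x -> J (w * x * s).
Proof.
case=> _ _ Jl Jr ws Jx; case: (sd) Jl Jr ws => Jl Jr /= [E1 E2].
- by rewrite E2 mulr1; exact: Jl.
- by rewrite E1 mul1r; exact: Jr.
- by apply: Jr => //; exact: Jl.
Qed.

Lemma ideal_gen_ideal (S : set L) : is_ideal sd (ideal_gen sd S).
Proof.
split.
- by move=> J [[]].
- by move=> x y Jx Jy J JS; have [[_ JD _ _] _] := JS; exact: JD (Jx J JS) (Jy J JS).
- by move=> h a x Jx J JS; have [[_ _ JM _] _] := JS; exact: JM h _ _ (Jx J JS).
- by move=> h a x Jx J JS; have [[_ _ _ JM] _] := JS; exact: JM h _ _ (Jx J JS).
Qed.

Lemma sub_ideal_gen (S : set L) : S `<=` ideal_gen sd S.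
Proof. by move=> x Sx J [_]; exact. Qed.

Lemma ideal_gen_sub (S J : set L) : is_ideal sd J -> S `<=` J -> ideal_gen sd S `<=` J.
Proof. by move=> iJ SJ x; apply. Qed.

(* A set of elements whose leading monomials divide all those of an ideal
   generates it, by iterated cancellation of leading terms. *)
Lemma divides_ideal_gen (B : set L) prec J (G : set L) :
  is_basis B -> monomial_ordering sd B prec -> B 1 ->
  is_ideal sd J -> G `<=` J -> (forall g, G g -> g <> 0) ->
  (forall f, J f -> f <> 0 ->
     exists2 g, G g & divides sd B prec (LM B prec g) (LM B prec f)) ->
  ideal_gen sd G = J.
Proof.
move=> bB mo B1 iJ GJ G0 Gd; apply/seteqP; split; first exact: ideal_gen_sub.
have iG := ideal_gen_ideal G; have wo := mo_well_order mo.
apply: (LM_ind bB wo (Q := fun f => J f -> ideal_gen sd G f)).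
  by case: iG.
move=> f f0 IH Jf; have [g Gg [w [s [ws E]]]] := Gd f Jf f0.
have [k kP] := LM_reduce bB mo B1 f0 (G0 g Gg) ws E.
have Jh : ideal_gen sd G (k *: (w * g * s)).
  apply: (is_ideal_scale _ iG); apply: (is_ideal_mul iG ws).
  exact: sub_ideal_gen.
rewrite -[f](subrK (k *: (w * g * s))); case: (iG) => _ GD _ _; apply: GD => //.
apply: IH => //; apply: (is_ideal_sub iJ Jf).
exact: (ideal_gen_sub iJ GJ Jh).
Qed.

End Ideals.

(* Some v u s with v, s in B has a component along u, because 1 * u * 1 = u; then
   LM(v u s) = u, which the second axiom allows only for v = s = 1. *)
Lemma skew_basis_one (K : fieldType) (L : algType K) (gens : seq L) (B : set L) prec :
  skew_multiplicative_basis gens B -> monomial_ordering TwoSided B prec -> B 1.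
Proof.
move=> skew mo; have bB := smb_basis skew; have decB := basis_decomposition bB.
have [irr _ _ _] := mo_well_order mo.
have [|u u1] := part_neq0 decB (f := 1); first by apply/eqP; exact: oner_neq0.
have Bu := part_line_mem bB u1; apply: contrapT => nB1.
have uu f : part (line B) u f = 0 -> f <> u.
  by move=> f0 fu; apply: (basis_neq0 bB Bu); rewrite -f0 fu (part_id decB (line_id Bu)).
apply: (uu (1 * u * 1)); last by rewrite mul1r mulr1.
(* Both outer factors 1 are expanded in the basis, which reduces the claim to products of three
   basis elements. *)
apply: (part_ind decB (f := 1) (Q := fun x => part (line B) u (x * u * 1) = 0)).
- by rewrite !mul0r (part0 decB).
- by move=> x y x0 y0; rewrite mulrDl mulrDl (partD decB) x0 y0 addr0.
move=> v; have [->|/eqP v0] := eqVneq (part (line B) v 1) 0.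
  by rewrite !mul0r (part0 decB).
have Bv := part_line_mem bB v0; have [k -> _] := part_lineE bB v 1.
apply: (part_ind decB (f := 1) (Q := fun y => part (line B) u (k *: v * u * y) = 0)).
- by rewrite mulr0 (part0 decB).
- by move=> y z y0 z0; rewrite mulrDr (partD decB) y0 z0 addr0.
move=> s; have [->|/eqP s0] := eqVneq (part (line B) s 1) 0.
  by rewrite mulr0 (part0 decB).
have Bs := part_line_mem bB s0; have [l -> _] := part_lineE bB s 1.
rewrite -scalerAr -!scalerAl !(partZ decB).
suff -> : part (line B) u (v * u * s) = 0 by rewrite !scaler0.
apply: contrapT => vus0.
(* Skew multiplicativity makes [v * u * s] zero or a nonzero multiple of a single [z] in [B]; a
   component along [u] forces [z = u]. *)
have [vu0|[a [w [a0 Bw vuE]]]] := smb_mul skew Bv Bu.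
  by apply: vus0; rewrite vu0 mul0r (part0 decB).
have [ws0|[b [z [b0 Bz wsE]]]] := smb_mul skew Bw Bs.
  by apply: vus0; rewrite vuE -scalerAl ws0 scaler0 (part0 decB).
have vusE : v * u * s = (a * b) *: z by rewrite vuE -scalerAl wsE scalerA.
have uz : u = z.
  apply: (part_line_basis bB Bz) => z0.
  by apply: vus0; rewrite vusE (partZ decB) z0 scaler0.
apply: (irr u Bu); apply: (mo_dvd mo (v := v) (s := s)) => //.
  by left => v1; apply: nB1; rewrite -v1.
rewrite vusE (LM_scale bB (mo_well_order mo) Bz) ?mulf_neq0 //.
Qed.

(** * Graded algebras *)

Section Gradings.
Variables (d : Order.disp_t) (Gam : orderedSemigroupType d).
Variables (K : fieldType) (L : algType K) (Lg : Gam -> set L).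
Hypothesis Lg_grading : grading Lg.

Lemma grading_decomposition : decomposition Lg.
Proof. by case: Lg_grading => *; split. Qed.
Let decL := grading_decomposition.

(** The filtration by degree: a bound, not the exact degree, so that 0 is included and sums stay
    inside. *)
Definition degree_le (g : Gam) (f : L) : Prop :=
  forall h, part Lg h f <> 0 -> (h <= g)%O.

Lemma degree_le_part g f h : degree_le g f -> (g < h)%O -> part Lg h f = 0.
Proof. by move=> fg gh; apply: contrapT => /fg; rewrite leNgt gh. Qed.

Lemma degree_leD g k f f' : degree_le g f -> degree_le g f' -> degree_le g (k *: f + f').
Proof.
move=> fg f'g h; rewrite (part_lin decL) => h0.
have [h1|/eqP h1] := eqVneq (part Lg h f) 0; last exact: fg.
by apply: f'g => h2; apply: h0; rewrite h1 h2 scaler0 addr0.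
Qed.

Lemma degree_le0 g : degree_le g 0.
Proof. by move=> h; rewrite (part0 decL). Qed.

Lemma degree_le_homogeneous g f : Lg g f -> degree_le g f.
Proof.
by move=> fg h; have [->//|hg] := eqVneq h g; rewrite (part_neq decL fg hg).
Qed.

Lemma degree_le_trans g h f : (g <= h)%O -> degree_le g f -> degree_le h f.
Proof. by move=> gh fg k /fg kg; exact: le_trans gh. Qed.

Lemma top_degree f : f <> 0 -> exists2 g, part Lg g f <> 0 & degree_le g f.
Proof.
have [s [_ sE _]] := part_supp decL f => f0.
have [g0 /eqP] := part_neq0 decL f0; rewrite -sE => g0s.
have [g gs gM] : exists2 g, g \in s & forall h, h \in s -> (h <= g)%O.
  elim: s {sE} g0 g0s => // a [|b s] IH g0 _.
    by exists a => [|h]; rewrite inE // => /eqP ->.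
  have [|g gs gM] := IH b; first exact: mem_head.
  have [ag|ga] := leP a g.
    exists g; first by rewrite inE gs orbT.
    by move=> h; rewrite inE => /orP[/eqP ->|/gM].
  exists a; first exact: mem_head.
  move=> h; rewrite inE => /orP[/eqP -> //|/gM hg].
  exact/ltW/(le_lt_trans hg).
exists g; first by apply/eqP; rewrite -sE.
by move=> h /eqP; rewrite -sE; exact: gM.
Qed.

Lemma part_mul_eq0 m f f' :
  (forall h k, part Lg h f <> 0 -> part Lg k f' <> 0 -> (h * k)%g <> m) ->
  part Lg m (f * f') = 0.
Proof.
move=> hk.
have [s [_ sE fE]] := part_supp decL f; have [s' [_ sE' fE']] := part_supp decL f'.
rewrite fE fE' mulr_suml.
have sum0 (r : seq Gam) (F : Gam -> L) : (forall h, h \in r -> part Lg m (F h) = 0) ->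
    part Lg m (\sum_(h <- r) F h) = 0.
  elim: r => [|h r IH] F0; first by rewrite big_nil (part0 decL).
  rewrite big_cons (partD decL) F0 ?mem_head // IH ?addr0 // => k kr.
  by apply: F0; rewrite inE kr orbT.
apply: (sum0) => h hs; rewrite mulr_sumr; apply: sum0 => k ks.
apply: (part_neq decL (gradingM Lg_grading (part_in decL h f) (part_in decL k f'))).
by rewrite eq_sym; apply/eqP/hk; apply/eqP; rewrite -?sE -?sE'.
Qed.

(** A strict inequality in either factor makes the product strictly smaller. The second part serves
    as the cancellation law that isolates top components. *)
Lemma mulg_le_eq (g g' h h' : Gam) : (g <= g')%O -> (h <= h')%O ->
  (g * h <= g' * h')%O%g /\ ((g * h)%g = (g' * h')%g -> g = g' /\ h = h').
Proof.
rewrite !le_eqVlt => /orP[/eqP ->|gg] /orP[/eqP ->|hh].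
- by rewrite eqxx.
- have E := ltgM2l g' _ _ hh; rewrite E orbT; split => // F.
  by rewrite F ltxx in E.
- have E := ltgM2r h' _ _ gg; rewrite E orbT; split => // F.
  by rewrite F ltxx in E.
- have E := lt_trans (ltgM2l g _ _ hh) (ltgM2r h' _ _ gg); rewrite E orbT; split => // F.
  by rewrite F ltxx in E.
Qed.

Lemma degree_leM g h f f' : degree_le g f -> degree_le h f' ->
  degree_le (g * h)%g (f * f') /\
  part Lg (g * h)%g (f * f') = part Lg g f * part Lg h f'.
Proof.
move=> fg fh; split.
  move=> m; apply: contraPT; rewrite -ltNge => ghm; apply; apply: part_mul_eq0.
  move=> a b /fg ag /fh bh abm; move: ghm; rewrite -abm.
  by have [+ _] := mulg_le_eq ag bh; rewrite leNgt => /negPf ->.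
set a := part Lg g f; set b := part Lg h f'.
have ag : Lg g a by exact: part_in.
have bh : Lg h b by exact: part_in.
(* Besides the product of the top components, each summand has a factor with no component at its
   bound, hence contributes nothing in degree [(g * h)%g]. *)
have -> : f * f' = a * b + (a * (f' - b) + (f - a) * f').
  by rewrite mulrBr mulrBl addrA [a * b + _]addrC subrK addrC subrK.
rewrite !(partD decL) (part_id decL (gradingM Lg_grading ag bh)).
rewrite !part_mul_eq0 ?addr0 // => k l.
  move=> kf /fh lh kl.
  have kg : (k <= g)%O.
    apply: contra_notT kf; rewrite -ltNge => gk.
    rewrite (partB decL) (part_neq decL ag) ?gt_eqF // subr0.
    exact: degree_le_part gk.
  have [_ /(_ kl)[kE _]] := mulg_le_eq kg lh.
  by apply: kf; rewrite kE (partB decL) (part_id decL ag) subrr.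
move=> ka lf kl.
have kg := degree_le_homogeneous ag ka.
have lh : (l <= h)%O.
  apply: contra_notT lf; rewrite -ltNge => hl.
  rewrite (partB decL) (part_neq decL bh) ?gt_eqF // subr0.
  exact: degree_le_part hl.
have [_ /(_ kl)[_ lE]] := mulg_le_eq kg lh.
by apply: lf; rewrite lE (partB decL) (part_id decL bh) subrr.
Qed.

Lemma leading_partP f g r :
  leading_part Lg f g r <-> [/\ r = part Lg g f, r <> 0 & degree_le g f].
Proof.
split.
- move=> [s [c [us fE sP [gs sm] ->]]].
  have pE h : part Lg h f = if h \in s then c h else 0.
    by rewrite fE partE // => k /sP[].
  split; [by rewrite pE gs | by have [] := sP g gs |].
  by move=> h; rewrite pE; case: ifP => // hs _; exact: sm.
- move=> [rE r0 fg]; have [s [us sE fE]] := part_supp decL f.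
  exists s, (fun h => part Lg h f); split => //.
  + by move=> h; rewrite sE => /eqP h0; split => //; exact: part_in.
  + rewrite sE -rE; split; first exact/eqP.
    by move=> h; rewrite sE => /eqP/fg.
Qed.

Lemma has_degreeE g h x : Lg g x -> x <> 0 -> has_degree Lg x h <-> h = g.
Proof.
move=> gx x0; split.
  move=> [r /leading_partP[-> hx _]]; have [//|hg] := eqVneq h g.
  by rewrite (part_neq decL gx hg) in hx.
move=> ->; exists x; apply/leading_partP; split => //; first by rewrite (part_id decL gx).
exact: degree_le_homogeneous.
Qed.

Lemma LH_top f : LH Lg f = 0 \/ exists2 g, degree_le g f & LH Lg f = part Lg g f.
Proof.
rewrite /LH; case: xgetP => [r _ [g /leading_partP[-> _ fg]]|]; last by left.
by right; exists g.
Qed.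

Lemma LH_eq g f : degree_le g f -> part Lg g f <> 0 -> LH Lg f = part Lg g f.
Proof.
move=> fg f0; apply: xget_unique.
  by exists g; apply/leading_partP.
move=> r [h /leading_partP[-> h0 fh]]; congr part.
by apply: le_anti; rewrite (fg h h0) (fh g f0).
Qed.

(** * Ideals determined by their homogeneous elements *)

Section HomogeneousSets.
Variables (sd : side) (Q : Gam -> set L).
Hypotheses (QL : forall g, Q g `<=` Lg g) (Q0 : forall g, Q g 0)
  (QD : forall g x y, Q g x -> Q g y -> Q g (x + y))
  (QMl : sd <> RightSided -> forall g h a x, Lg g a -> Q h x -> Q (g * h)%g (a * x))
  (QMr : sd <> LeftSided -> forall g h a x, Lg g a -> Q h x -> Q (h * g)%g (x * a)).

(** Applied below to the leading components of [I] in each degree, and to the symbols of an ideal of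
    the quotient by [I]. *)
Let span := [set x | forall g, Q g (part Lg g x)].

Let spanD x y : span x -> span y -> span (x + y).
Proof. by move=> xs ys g; rewrite (partD decL); exact: QD. Qed.

Let span0 : span 0. Proof. by move=> g; rewrite (part0 decL). Qed.

Lemma homogeneous_span g x : Q g x -> span x.
Proof.
move=> Qx h; have [->|hg] := eqVneq h g; first by rewrite (part_id decL) //; exact: QL.
by rewrite (part_neq decL _ hg) //; exact: QL.
Qed.

Lemma span_ideal : is_ideal sd span.
Proof.
split => //.
- move=> side a x xs.
  apply: (part_ind decL (f := a) (Q := fun a => span (a * x))).
  + by rewrite mul0r.
  + by move=> b c bs cs; rewrite mulrDl; exact: spanD.
  move=> g; set b := part Lg g a; have bg : Lg g b by exact: part_in.
  apply: (part_ind decL (f := x) (Q := fun x => span (b * x))).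
  + by rewrite mulr0.
  + by move=> y z ys zs; rewrite mulrDr; exact: spanD.
  by move=> h; apply: homogeneous_span (QMl side bg (xs h)).
- move=> side a x xs.
  apply: (part_ind decL (f := a) (Q := fun a => span (x * a))).
  + by rewrite mulr0.
  + by move=> b c bs cs; rewrite mulrDr; exact: spanD.
  move=> g; set b := part Lg g a; have bg : Lg g b by exact: part_in.
  apply: (part_ind decL (f := x) (Q := fun x => span (x * b))).
  + by rewrite mul0r.
  + by move=> y z ys zs; rewrite mulrDl; exact: spanD.
  by move=> h; apply: homogeneous_span (QMr side bg (xs h)).
Qed.

Lemma span_graded : graded_ideal Lg sd span.
Proof.
split; first exact: span_ideal.
move=> f fs; have [s [us sE fE]] := part_supp decL f.
exists [seq part Lg h f | h <- s]; rewrite big_map; split => // x /mapP[h hs ->].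
by split; [exact: homogeneous_span (fs h) | exists h; exact: part_in].
Qed.

End HomogeneousSets.

Section GradedOrderings.
Variables (sd : side) (B : set L) (prec : L -> L -> Prop).
Hypothesis gmo : graded_monomial_ordering sd Lg B prec.
Let bB : is_basis B := (gmo_admissible gmo).1.
Let decB := basis_decomposition bB.
Let wo := mo_well_order (gmo_admissible gmo).2.

(** Basis vectors are homogeneous, so passing to the component of degree [g] only deletes basis
    terms of other degrees. *)
Lemma part_line_part g u f : Lg g u ->
  part (line B) u (part Lg g f) = part (line B) u f.
Proof.
move=> gu; apply: (part_ind decB (f := f)
  (Q := fun f => part (line B) u (part Lg g f) = part (line B) u f)).
- by rewrite (part0 decL).
- by move=> x y xE yE; rewrite (partD decL) !(partD decB) xE yE.
move=> v; set x := part (line B) v f.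
have xv : line B v x by exact: part_in.
have [k xE _] := part_lineE bB v f; rewrite -/x in xE.
have [uv|uv] := eqVneq u v.
  by rewrite uv in gu *; rewrite (part_id decL) // xE -[_ *: _]addr0;
    apply: (decZD decL) => //; exact: dec0.
rewrite (part_neq decB xv uv).
have [->|/eqP x0] := eqVneq x 0; first by rewrite (part0 decL) (part0 decB).
have [h hv] := gmo_homogeneous gmo (part_line_mem bB x0).
have hx : Lg h x by rewrite xE -[_ *: _]addr0; apply: (decZD decL) => //; exact: dec0.
have [->|gh] := eqVneq g h; first by rewrite (part_id decL hx) (part_neq decB xv uv).
by rewrite (part_neq decL hx gh) (part0 decB).
Qed.

Lemma part_line_part_neq g h u f : Lg g u -> h != g -> part (line B) u (part Lg h f) = 0.
Proof.
move=> gu hg; rewrite -(part_line_part _ gu).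
by rewrite (part_neq decL (part_in decL h f)) 1?eq_sym // (part0 decB).
Qed.

(** The graded ordering compares degrees before [prec0], so every monomial of lower degree lies
    below the leading one of the top component. *)
Lemma LM_top g f : degree_le g f -> part Lg g f <> 0 ->
  LM B prec f = LM B prec (part Lg g f).
Proof.
move=> fg f0; set m := LM B prec (part Lg g f).
have /(leading_termP bB)[] := LM_leading bB wo f0; rewrite -/m => m0 mM.
have Bm := part_line_mem bB m0; have [h hm] := gmo_homogeneous gmo Bm.
have hg : g = h.
  have [//|gh] := eqVneq g h; by rewrite (part_line_part_neq _ hm gh) in m0.
rewrite -{h}hg in hm.
apply: (leading_termE bB wo); apply/(leading_termP bB); split.
  by rewrite -(part_line_part _ hm).
move=> v v0 vm; have Bv := part_line_mem bB v0.
have [h hv] := gmo_homogeneous gmo Bv.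
have hg : (h <= g)%O.
  by apply: fg => h0; apply: v0; rewrite -(part_line_part _ hv) h0 (part0 decB).
move: hg; rewrite le_eqVlt => /orP[/eqP hg|hg].
  by apply: mM => //; rewrite -hg (part_line_part _ hv).
have [prec0 [_ ->//]] := gmo_graded gmo.
exists h, g; split; [| |by left].
- by apply/(has_degreeE _ hv) => //; exact: basis_neq0 Bv.
- by apply/(has_degreeE _ hm) => //; exact: basis_neq0 Bm.
Qed.

End GradedOrderings.
End Gradings.

(** * Quotients and normal monomials *)

Section QuotientBasis.
Variables (K : fieldType) (R : algType K) (J : properIdeal R).

Lemma coset_eq0 x : coset J x = 0 <-> properIdeal_set J x.
Proof. by rewrite -[0]/(coset J 0) QuotientAlgebra.cosetE subr0. Qed.

Variables (B N : set R).
Hypotheses (bB : is_basis B) (NB : N `<=` B).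
Let decB := basis_decomposition bB.

(** With [N] the normal monomials, these elements represent the classes of both quotients uniquely,
    and coordinates are compared through them. *)
Definition supported (f : R) : Prop := forall v, part (line B) v f <> 0 -> N v.

Lemma supportedD f f' : supported f -> supported f' -> supported (f + f').
Proof.
move=> fN f'N v; rewrite (partD decB) => h.
have [v0|/eqP v0] := eqVneq (part (line B) v f) 0; last exact: fN.
by apply: f'N => v0'; apply: h; rewrite v0 v0' addr0.
Qed.

Lemma supported0 : supported 0.
Proof. by move=> v; rewrite (part0 decB). Qed.

Lemma supported_scale k u : N u -> supported (k *: u).
Proof.
move=> Nu v; have [-> //|vu] := eqVneq v u.
by rewrite (part_neq decB (line_mem k (NB Nu)) vu).
Qed.

Hypothesis bN : is_basis (coset J @` N).
Hypothesis cosetN_inj : forall u v, N u -> N v -> coset J u = coset J v -> u = v.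
Let decN := basis_decomposition bN.

(** The elements of [N] stay distinct and independent modulo [J], so a supported [f] keeps its
    coordinates in the quotient. *)
Lemma part_coset_line u f : N u -> supported f ->
  part (line (coset J @` N)) (coset J u) (coset J f) = coset J (part (line B) u f).
Proof.
move=> Nu fN; apply: (part_ind decB (f := f) (Q := fun f =>
  part (line (coset J @` N)) (coset J u) (coset J f) = coset J (part (line B) u f))).
- by rewrite (part0 decB) linear0 (part0 decN).
- by move=> x y xE yE; rewrite linearD /= (partD decN) xE yE (partD decB) linearD.
move=> v; have [->|/eqP v0] := eqVneq (part (line B) v f) 0.
  by rewrite (part0 decB) linear0 (part0 decN).
have Nv := fN v v0; have [k -> _] := part_lineE bB v f.
have vl : line (coset J @` N) (coset J v) (k *: coset J v).
  by apply: line_mem; exists v.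
rewrite linearZ /=; have [->|uv] := eqVneq u v.
  by rewrite (part_id decN vl) (part_id decB (line_mem k (NB Nv))) linearZ.
rewrite (part_neq decB (line_mem k (NB Nv)) uv) linear0 (part_neq decN vl) //.
by apply: contra_neq uv; exact: cosetN_inj.
Qed.

Lemma supported_lift x : exists2 f, supported f & x = coset J f.
Proof.
have [s [c [sN ->]]] := bN.1 x; elim: s sN => [|y s IH] sN.
  by exists 0; [exact: supported0 | rewrite big_nil linear0].
have [|f fN fE] := IH; first by move=> z zs; apply: sN; rewrite inE zs orbT.
have [u Nu uE] := sN y (mem_head _ _).
exists (c y *: u + f); first by apply: supportedD => //; exact: supported_scale.
by rewrite big_cons fE linearD linearZ /= uE.
Qed.

Lemma supported_eq0 f : supported f -> coset J f = 0 -> f = 0.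
Proof.
move=> fN f0; apply: (part_eq0 decB) => v; apply: contrapT => v0.
have Nv := fN v v0; have := part_coset_line Nv fN.
rewrite f0 (part0 decN); have [k kE k0] := part_lineE bB v f; rewrite kE linearZ /=.
move=> /esym/eqP; rewrite scaler_eq0 => /orP[k0'|/eqP].
  by move: (k0.2 v0); rewrite k0'.
by apply: (basis_neq0 bN); exists v.
Qed.

End QuotientBasis.

(** * The grading of a quotient by a homogeneous ideal *)

Section QuotientGrading.
Variables (d : Order.disp_t) (Gam : orderedSemigroupType d).
Variables (K : fieldType) (R : algType K) (J : properIdeal R) (Rg : Gam -> set R).
Hypothesis Rg_grading : grading Rg.
Hypothesis J_homogeneous : forall x, properIdeal_set J x ->
  forall g, properIdeal_set J (part Rg g x).
Let decR := grading_decomposition Rg_grading.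
Local Notation Qg := (quot_grading J Rg).

Lemma quot_grading_grading : grading Qg.
Proof.
split.
- by move=> g; exists 0; [exact: grading0 | rewrite linear0].
- move=> g k _ _ [x gx <-] [y gy <-]; exists (k *: x + y); last by rewrite linearP.
  exact: gradingZD.
- move=> g h _ _ [x gx <-] [y hy <-]; exists (x * y); last by rewrite rmorphM.
  exact: gradingM.
- move=> x; have [f ->] := QuotientAlgebra.coset_surj x.
  have [s [us _ fE]] := part_supp decR f.
  exists s, (fun g => coset J (part Rg g f)); split => //.
    by move=> g _; exists (part Rg g f) => //; exact: part_in.
  by rewrite {1}fE linear_sum.
- move=> s c us cP c0.
  (* Directness: homogeneous lifts of the terms have their sum in [J], so homogeneity of [J] puts
     each lift in [J]. *)
  have /choice[r rP] : forall g, exists r, g \in s -> Rg g r /\ coset J r = c g.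
    move=> g; have [/cP[r gr rE]|_] := boolP (g \in s); last by exists 0.
    by exists r.
  have : coset J (\sum_(g <- s) r g) = 0.
    by rewrite linear_sum -[RHS]c0; apply: eq_big_seq => g /rP[].
  move=> /coset_eq0/J_homogeneous J0 g gs; have [_ <-] := rP g gs.
  apply/coset_eq0; have := J0 g; rewrite partE ?gs // => h hs.
  by case: (rP h hs).
Qed.

Lemma part_coset g f : part Qg g (coset J f) = coset J (part Rg g f).
Proof.
have decQ := grading_decomposition quot_grading_grading.
apply: (part_ind decR (f := f)
  (Q := fun f => part Qg g (coset J f) = coset J (part Rg g f))).
- by rewrite (part0 decR) linear0 (part0 decQ).
- by move=> x y xE yE; rewrite linearD /= (partD decQ) xE yE (partD decR) linearD.
move=> h; set x := part Rg h f; have hx : Rg h x by exact: part_in.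
have hx' : Qg h (coset J x) by exists x.
have [->|gh] := eqVneq g h; first by rewrite (part_id decR hx) (part_id decQ hx').
by rewrite (part_neq decR hx gh) (part_neq decQ hx' gh) linear0.
Qed.

End QuotientGrading.

(** * Normal words as representatives modulo an ideal *)

Section NormalMonomials.
Variables (K : fieldType) (R : algType K).
Variables (gens : seq R) (B : set R) (prec : R -> R -> Prop) (I : properIdeal R).
Hypothesis skew : skew_multiplicative_basis gens B.
Hypothesis mo : monomial_ordering TwoSided B prec.
Let bB := smb_basis skew.
Let decB := basis_decomposition bB.
Let wo := mo_well_order mo.
Let B1 : B 1. Proof. exact: skew_basis_one skew mo. Qed.
Local Notation N := (normal_monomials B prec I).
Let NB : N `<=` B. Proof. by move=> u []. Qed.

Lemma LM_ideal_notin f : properIdeal_set I f -> f <> 0 -> ~ N (LM B prec f).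
Proof.
move=> If f0 [_ /(_ f If f0)]; apply.
by exists 1, 1, 1; rewrite oner_neq0 mul1r mulr1 scale1r; split.
Qed.

Lemma ideal_supported_eq0 f : properIdeal_set I f -> supported B N f -> f = 0.
Proof.
move=> If fN; apply: contrapT => f0; apply: (LM_ideal_notin If f0).
by apply: fN; have /(leading_termP bB)[] := LM_leading bB wo f0.
Qed.

Lemma coset_normal_inj u v : N u -> N v -> coset I u = coset I v -> u = v.
Proof.
move=> Nu Nv /QuotientAlgebra.cosetE Iuv; apply: subr0_eq.
apply: ideal_supported_eq0 => //; rewrite -scaleN1r -[u]scale1r.
by apply: (supportedD bB); exact: (supported_scale bB NB).
Qed.

(** Division by all of [I], by induction on the leading monomial: a normal one is moved to the
    remainder, any other is cancelled by a multiple of an element of [I]. *)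
Lemma normal_form f : exists2 r, supported B N r & properIdeal_set I (f - r).
Proof.
have iI := properIdeal_ideal I; have [I0 ID _ _] := iI.
apply: (LM_ind bB wo (Q := fun f => exists2 r, supported B N r & properIdeal_set I (f - r))).
  by exists 0; [exact: supported0 | rewrite subrr].
move=> {}f f0 IH; have Bm := LM_mem bB wo f0.
have [Nm|nNm] := pselect (N (LM B prec f)).
  have [k kP] := LM_cancel bB wo f0 (basis_neq0 bB Bm) (esym (LM_id bB wo Bm)).
  have [r rN Ir] := IH _ kP.
  exists (k *: LM B prec f + r); last by rewrite opprD addrA.
  by apply: (supportedD bB) => //; exact: (supported_scale bB NB).
have [g [Ig g0 [w [s [k [Bw Bs k0 E]]]]]] : exists g,
    [/\ properIdeal_set I g, g <> 0 & skew_divides B (LM B prec g) (LM B prec f)].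
  apply: contrapT => h; apply: nNm; split => // g Ig g0 gd; apply: h; by exists g.
have E' : LM B prec f = LM B prec (w * LM B prec g * s).
  have -> : w * LM B prec g * s = k^-1 *: LM B prec f.
    by rewrite E scalerA mulVf // scale1r.
  by rewrite (LM_scale bB wo Bm) // invr_eq0.
have [l lP] := LM_reduce bB mo B1 (w := w) (s := s) f0 g0 (conj Bw Bs) E'.
have [r rN Ir] := IH _ lP; exists r => //.
rewrite -[f](subrK (l *: (w * g * s))) addrAC; apply: ID => //.
apply: (is_ideal_scale _ iI).
exact: (is_ideal_mul iI (B := B) (w := w) (s := s) (conj Bw Bs)).
Qed.

Lemma normal_basis : is_basis (coset I @` N).
Proof.
(* [is_basis] indexes coefficients by classes; the section [rho] translates them to and from
   coefficients of words. *)
have /choice[rho rhoP] : forall x : quot I, exists u,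
    (coset I @` N) x -> N u /\ coset I u = x.
  move=> x; have [[u Nu <-]|nx] := pselect ((coset I @` N) x); first by exists u.
  by exists 0 => /nx.
split.
- move=> x; have [f ->] := QuotientAlgebra.coset_surj x.
  have [r rN /QuotientAlgebra.cosetE ->] := normal_form f.
  have [s [us sE rE]] := part_supp decB r.
  have /choice[k kP] : forall u, exists k : K, part (line B) u r = k *: u.
    by move=> u; have [k] := part_lineE bB u r; exists k.
  have sN u : u \in s -> N u by rewrite sE => /eqP/rN.
  exists [seq coset I u | u <- s], (fun x => k (rho x)); split.
    by move=> y /mapP[u /sN Nu ->]; exists u.
  rewrite big_map {1}rE linear_sum; apply: eq_big_seq => u us0 /=.
  have Nu := sN u us0; rewrite kP linearZ /=; congr (k _ *: _).
  have [|Nr rE'] := rhoP (coset I u); first by exists u.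
  exact: coset_normal_inj.
- move=> s c us sN c0.
  have rK x : x \in s -> coset I (rho x) = x by move=> /sN/rhoP[].
  have rN x : x \in s -> N (rho x) by move=> /sN/rhoP[].
  have ur : uniq [seq rho x | x <- s].
    by rewrite map_inj_in_uniq // => x y /rK xE /rK yE rxy; rewrite -xE rxy yE.
  have := bB.2 _ (fun u => c (coset I u)) ur.
  have /[swap]/[apply] : forall u, u \in [seq rho x | x <- s] -> B u.
    by move=> u /mapP[x /rN Nr ->]; exact: NB.
  rewrite big_map.
  have -> : \sum_(x <- s) c (coset I (rho x)) *: rho x = \sum_(x <- s) c x *: rho x.
    by apply: eq_big_seq => x xs; rewrite rK.
  have rs0 : \sum_(x <- s) c x *: rho x = 0.
    apply: ideal_supported_eq0.
      apply/coset_eq0; rewrite linear_sum -[RHS]c0; apply: eq_big_seq => x xs.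
      by rewrite linearZ /= rK.
    rewrite big_seq; apply: (big_ind (supported B N)).
    + exact: supported0.
    + by move=> x y; exact: supportedD.
    + by move=> x xs; apply: (supported_scale bB NB); exact: rN.
  by move=> /(_ rs0) h x xs; rewrite -(rK x xs); apply: h; exact: map_f.
Qed.

(** If the leading monomial of some [f] in [I] divided 1, it would be 1, the least monomial; then
    [f] would be a nonzero scalar and [I] not proper. *)
Lemma normal1 : N 1.
Proof.
have iI := properIdeal_ideal I; have [irr tr _ _] := wo.
split=> // f If f0 [w [s [k [Bw Bs k0 E]]]].
have Bm := LM_mem bB wo f0; set m := LM B prec f in Bm E.
have E' : 1 = LM B prec (w * m * s).
  have -> : w * m * s = k^-1 *: 1 by rewrite E scalerA mulVf // scale1r.
  by rewrite (LM_scale bB wo B1) // invr_eq0.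
have m1 : m = 1.
  have [//|/eqP m1] := eqVneq m 1.
  have [ws|ws] := pselect (w <> 1 \/ s <> 1).
    have h := mo_dvd mo Bm B1 (conj Bw Bs) ws E'.
    by case: (irr 1 B1); apply: (tr _ m) => //; exact: (one_min bB mo B1).
  have w1 : w = 1 by apply: contrapT => w1; apply: ws; left.
  have s1 : s = 1 by apply: contrapT => s1; apply: ws; right.
  by move: E'; rewrite w1 s1 mul1r mulr1 (LM_id bB wo Bm).
have [l lP] := LM_cancel bB wo f0 (basis_neq0 bB B1)
  (etrans (m1 : LM B prec f = 1) (esym (LM_id bB wo B1))).
rewrite -/m m1 in lP; have {}lP : f - l *: 1 = 0.
  case: lP => // h; apply: contrapT => h0; apply: (irr 1 B1).
  have Bn := LM_mem bB wo h0.
  have [E1|/eqP n1] := eqVneq (LM B prec (f - l *: 1)) 1; first by rewrite {1}E1 in h.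
  by apply: (tr _ (LM B prec (f - l *: 1))) => //; exact: (one_min bB mo B1).
move/subr0_eq: lP => fE; apply: (properIdeal_proper (p := I)).
apply/seteqP; split=> // x _; have [_ _ IM _] := iI.
have l0 : l != 0 by apply/eqP => l0; apply: f0; rewrite fE l0 scale0r.
rewrite -[x]mulr1 -[1](scalerK l0) -fE; apply: IM => //.
exact: (is_ideal_scale _ iI).
Qed.

End NormalMonomials.

(** * Transfer along symbols *)

Section Transfer.
Variables (d : Order.disp_t) (Gam : orderedSemigroupType d) (K : fieldType) (R : algType K).
Variables (gens : seq R) (Rg : Gam -> set R) (B : set R) (prec_gr : R -> R -> Prop).
Variables (I ILH : properIdeal R).
Hypotheses (Rg_grading : grading Rg) (skew : skew_multiplicative_basis gens B)
  (gmo : graded_monomial_ordering TwoSided Rg B prec_gr)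
  (ILH_def : ILH = ideal_gen TwoSided (LH Rg @` I) :> set R).
Let decR := grading_decomposition Rg_grading.
Let mo := (gmo_admissible gmo).2.
Let bB := smb_basis skew.
Let decB := basis_decomposition bB.
Let wo := mo_well_order mo.
Let B1 : B 1. Proof. exact: skew_basis_one skew mo. Qed.
Local Notation N := (normal_monomials B prec_gr I).
Let NB : N `<=` B. Proof. by move=> u []. Qed.
Local Notation Nhat := (coset ILH @` N).
Local Notation Nbar := (coset I @` N).
Local Notation Ag := (quot_grading ILH Rg).

Let top_part_ILH g f : properIdeal_set I f -> degree_le Rg g f ->
  properIdeal_set ILH (part Rg g f).
Proof.
move=> If fg; have iL := properIdeal_ideal ILH.
have [->|/eqP f0] := eqVneq (part Rg g f) 0; first by case: iL.
rewrite ILH_def -(LH_eq Rg_grading fg f0).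
by apply: sub_ideal_gen; exists f.
Qed.

(** Components in degree [g] of elements of [I] of degree at most [g] are closed under sums and
    under products with homogeneous elements. Hence the elements all of whose components are of this
    kind form an ideal, and it contains the leading parts of [I]. *)
Let ILH_part x g : properIdeal_set ILH x ->
  exists2 f, properIdeal_set I f & degree_le Rg g f /\ part Rg g f = part Rg g x.
Proof.
have iI := properIdeal_ideal I; have [I0 ID IMl IMr] := iI.
pose Q g r := Rg g r /\
  exists2 f, properIdeal_set I f & degree_le Rg g f /\ part Rg g f = r.
rewrite ILH_def => Lx; suff [] : Q g (part Rg g x) by [].
move: g; have QL h : Q h `<=` Rg h by move=> y [].
have Q0 h : Q h 0.
  split; first exact: dec0.
  by exists 0 => //; split; [exact: degree_le0 | exact: part0].
have QD h y z : Q h y -> Q h z -> Q h (y + z).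
  move=> [hy [f If [fh fE]]] [hz [f' If' [f'h f'E]]]; split.
    by rewrite -[y]scale1r; exact: decZD.
  exists (f + f'); first exact: ID.
  split; last by rewrite (partD decR) fE f'E.
  by rewrite -[f]scale1r; exact: degree_leD.
have iQ : is_ideal TwoSided [set y | forall g, Q g (part Rg g y)].
  apply: (span_ideal Rg_grading (Q := Q)) => //.
  - move=> _ g h a y ga [hy [f If [fh fE]]]; split; first exact: gradingM.
    exists (a * f); first exact: IMl.
    have [? E] := degree_leM Rg_grading (degree_le_homogeneous Rg_grading ga) fh.
    by split => //; rewrite E fE (part_id decR ga).
  - move=> _ g h a y ga [hy [f If [fh fE]]]; split; first exact: gradingM.
    exists (f * a); first exact: IMr.
    have [? E] := degree_leM Rg_grading fh (degree_le_homogeneous Rg_grading ga).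
    by split => //; rewrite E fE (part_id decR ga).
apply: (ideal_gen_sub iQ _ Lx) => _ [f If <-].
have [->|[g fg ->]] := LH_top Rg_grading f; first by move=> g; rewrite (part0 decR).
apply: (homogeneous_span Rg_grading QL Q0 (g := g)).
by split; [exact: part_in | exists f].
Qed.

Let ILH_homogeneous x : properIdeal_set ILH x ->
  forall g, properIdeal_set ILH (part Rg g x).
Proof. by move=> Lx g; have [f If [fg <-]] := ILH_part g Lx; exact: top_part_ILH. Qed.

Let Ag_grading := quot_grading_grading Rg_grading ILH_homogeneous.
Let decA := grading_decomposition Ag_grading.

(** Otherwise the top component of [u - v] is also that of some [f] in [I]. As the ordering is
    graded, its leading monomial is that of [f], yet it occurs in [u - v] and so is normal. *)
Let iota_hat_inj u v : N u -> N v -> coset ILH u = coset ILH v -> u = v.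
Proof.
move=> Nu Nv /QuotientAlgebra.cosetE Luv; have [//|/eqP uv] := eqVneq u v.
have x0 : u - v <> 0 by move/subr0_eq.
have xN : supported B N (u - v).
  rewrite -scaleN1r -[u]scale1r; apply: (supportedD bB);
  exact: (supported_scale bB NB).
have [g gx _] := top_degree Rg_grading x0.
have [f If [fg fE]] := ILH_part g Luv; rewrite -fE in gx.
have f0 : f <> 0 by move=> f0; apply: gx; rewrite f0 (part0 decR).
case: (LM_ideal_notin skew mo If f0); rewrite (LM_top Rg_grading gmo fg gx) fE.
rewrite fE in gx.
have /(leading_termP bB)[m0 _] := LM_leading bB wo gx; set m := LM _ _ _ in m0 *.
apply: xN; have Bm := part_line_mem bB m0; have [h hm] := gmo_homogeneous gmo Bm.
have [gh|gh] := eqVneq g h; first by rewrite -(part_line_part Rg_grading gmo _ hm) -gh.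
by case: m0; exact: (part_line_part_neq Rg_grading gmo _ hm).
Qed.

(* [x] has a representative of degree at most [g] whose component of degree [g]
   represents [a]: this is the isomorphism between the associated graded
   algebra of [quot I] and [quot ILH]. *)
Definition symbol (g : Gam) (x : quot I) (a : quot ILH) : Prop :=
  exists f, [/\ coset I f = x, degree_le Rg g f & coset ILH (part Rg g f) = a].

Lemma symbol_homogeneous g x a : symbol g x a -> Ag g a.
Proof. by move=> [f [_ _ <-]]; exists (part Rg g f) => //; exact: part_in. Qed.

(** Two representatives differ by an element of [I] of degree at most [g], whose component of degree
    [g] lies in [ILH]. *)
Lemma symbol_uniq g x a b : symbol g x a -> symbol g x b -> a = b.
Proof.
move=> [f [<- fg <-]] [f' [/esym/QuotientAlgebra.cosetE If f'g <-]].
apply/QuotientAlgebra.cosetE; rewrite -(partB decR); apply: top_part_ILH => //.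
by rewrite addrC -scaleN1r; exact: degree_leD.
Qed.

Lemma symbol_lt g h x a : (g < h)%O -> symbol g x a -> symbol h x 0.
Proof.
move=> gh [f [fx fg _]]; exists f; split => //.
  exact: degree_le_trans (ltW gh) fg.
by rewrite (degree_le_part fg gh) linear0.
Qed.

(** In any degree above a valid bound the symbol is 0, so a nonzero symbol fixes the degree. *)
Lemma symbol_degree g h x a b : a <> 0 -> b <> 0 ->
  symbol g x a -> symbol h x b -> g = h /\ a = b.
Proof.
move=> a0 b0 ga hb; suff gh : g = h by split=> //; subst; exact: symbol_uniq hb.
case: (ltgtP g h) => // gh; [case: b0 | case: a0].
- exact: symbol_uniq hb (symbol_lt gh ga).
- exact: symbol_uniq ga (symbol_lt gh hb).
Qed.

Lemma symbol0 g : symbol g 0 0.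
Proof.
exists 0; rewrite (part0 decR) !linear0; split => //; exact: degree_le0.
Qed.

Lemma symbol_neq0 g x a : a <> 0 -> symbol g x a -> x <> 0.
Proof. by move=> a0 + x0; rewrite x0 => /(symbol_uniq (symbol0 g))/esym. Qed.

Lemma symbolD g x y a b : symbol g x a -> symbol g y b -> symbol g (x + y) (a + b).
Proof.
move=> [f [<- fg <-]] [f' [<- f'g <-]]; exists (f + f'); rewrite (partD decR) !linearD.
by split => //; rewrite -[f]scale1r; exact: degree_leD.
Qed.

Lemma symbolM g h x y a b :
  symbol g x a -> symbol h y b -> symbol (g * h)%g (x * y) (a * b).
Proof.
move=> [f [<- fg <-]] [f' [<- f'h <-]]; exists (f * f').
by have [? ->] := degree_leM Rg_grading fg f'h; rewrite !rmorphM.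
Qed.

Lemma symbol_lift g a : Ag g a -> exists x, symbol g x a.
Proof.
move=> [r gr <-]; exists (coset I r), r; split => //.
  exact: degree_le_homogeneous.
by rewrite (part_id decR gr).
Qed.

Lemma symbol_normal u : N u -> exists g, symbol g (coset I u) (coset ILH u).
Proof.
move=> [Bu _]; have [g gu] := gmo_homogeneous gmo Bu.
exists g, u; split => //; first exact: degree_le_homogeneous.
by rewrite (part_id decR gu).
Qed.

(** * Leading monomials and the monomial axioms in the two quotients *)

Variable sd : side.
Variable prec_hat : quot ILH -> quot ILH -> Prop.
Hypothesis gmo_hat : graded_monomial_ordering sd Ag Nhat prec_hat.
Hypothesis domain : is_domain (quot ILH).
Local Notation prec_bar := (transfer_order I N prec_hat).
Let mo_hat := (gmo_admissible gmo_hat).2.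
Let bNh : is_basis Nhat := (gmo_admissible gmo_hat).1.
Let bNb : is_basis Nbar := normal_basis I skew mo.
Let woh := mo_well_order mo_hat.
Let N1 : N 1 := normal1 I skew mo.
Let iota_bar_inj u v : N u -> N v -> coset I u = coset I v -> u = v.
Proof. exact: (coset_normal_inj skew mo). Qed.
Let Nh1 : Nhat 1. Proof. by exists 1; rewrite ?rmorph1. Qed.
Let Nb1 : Nbar 1. Proof. by exists 1; rewrite ?rmorph1. Qed.

Lemma transfer_orderE u v : N u -> N v ->
  prec_bar (coset I u) (coset I v) <-> prec_hat (coset ILH u) (coset ILH v).
Proof.
move=> Nu Nv; split; last by exists u, v.
by move=> [u' [v' [Nu' Nv' /iota_bar_inj -> // /iota_bar_inj -> //]]].
Qed.

Lemma transfer_well_order : well_order_on Nbar prec_bar.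
Proof.
have [irr tr tot wf] := woh; split.
- by move=> _ [u Nu <-] /(transfer_orderE Nu Nu); apply: irr; exists u.
- move=> _ _ _ [u Nu <-] [v Nv <-] [w Nw <-].
  move=> /(transfer_orderE Nu Nv) uv /(transfer_orderE Nv Nw) vw.
  apply/(transfer_orderE Nu Nw); apply: tr uv vw; by [exists u|exists v|exists w].
- move=> _ _ [u Nu <-] [v Nv <-].
  have [||uv|/iota_hat_inj ->//|vu] := tot (coset ILH u) (coset ILH v).
  + by exists u.
  + by exists v.
  + by constructor 1; apply/transfer_orderE.
  + by constructor 2.
  + by constructor 3; apply/transfer_orderE.
- move=> S SN [x Sx]; have [u Nu xE] := SN x Sx.
  have [||_ [v [Nv Sv] <-] vm] := wf (coset ILH @` [set u | N u /\ S (coset I u)]).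
  + by move=> _ [v [Nv _] <-]; exists v.
  + by exists (coset ILH u), u => //; split => //; rewrite xE.
  exists (coset I v) => // y Sy yv; have [w Nw wE] := SN y Sy; rewrite -wE in yv Sy *.
  apply/transfer_orderE => //; apply: vm; first by exists w.
  by move=> /iota_hat_inj wv; apply: yv; rewrite wv.
Qed.
Let wob := transfer_well_order.

(** A supported [f] has the same coordinate at each normal word in both quotients, and the two
    orders agree on normal words by construction. *)
Lemma LM_lift f : supported B N f -> f <> 0 -> exists u,
  [/\ N u, LM Nbar prec_bar (coset I f) = coset I u &
      LM Nhat prec_hat (coset ILH f) = coset ILH u].
Proof.
move=> fN f0.
have y0 : coset ILH f <> 0 by move/(supported_eq0 bB NB bNh iota_hat_inj fN).
have lth := LM_leading bNh woh y0.
have [u Nu uE] := LM_mem bNh woh y0; exists u; split => //.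
move/(leading_termP bNh): lth; rewrite -uE => -[u0 um].
apply: (leading_termE bNb wob); apply/(leading_termP bNb).
have hE v : N v -> part (line Nhat) (coset ILH v) (coset ILH f) <> 0 <->
    part (line Nbar) (coset I v) (coset I f) <> 0.
  move=> Nv; rewrite (part_coset_line bB NB bNh iota_hat_inj Nv fN).
  rewrite (part_coset_line bB NB bNb iota_bar_inj Nv fN).
  have [k -> _] := part_lineE bB v f; rewrite !linearZ /=.
  split=> h /eqP; rewrite scaler_eq0 => /orP[/eqP k0|/eqP].
  - by apply: h; rewrite k0 scale0r.
  - by apply: (basis_neq0 bNb); exists v.
  - by apply: h; rewrite k0 scale0r.
  - by apply: (basis_neq0 bNh); exists v.
split; first exact/hE.
move=> x x0; have [v Nv vE] := part_line_mem bNb x0; rewrite -vE in x0 *.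
move=> vu; apply/transfer_orderE => //; apply: um; first exact/hE.
by move=> /iota_hat_inj E; apply: vu; rewrite E.
Qed.


Lemma LM_symbol_exists x : x <> 0 -> exists g a u,
  [/\ symbol g x a, a <> 0 & [/\ N u, LM Nbar prec_bar x = coset I u &
      LM Nhat prec_hat a = coset ILH u]].
Proof.
have [f fN ->] := supported_lift bB NB bNb x => x0.
have f0 : f <> 0 by move=> f0; apply: x0; rewrite f0 linear0.
have y0 : coset ILH f <> 0 by move/(supported_eq0 bB NB bNh iota_hat_inj fN).
have [g gy yg] := top_degree Ag_grading y0.
have pE h : part Ag h (coset ILH f) = coset ILH (part Rg h f).
  exact: part_coset.
have [u uP] := LM_lift fN f0.
exists g, (part Ag g (coset ILH f)), u; split => //; last first.
  by rewrite -(LM_top Ag_grading gmo_hat yg gy).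
exists f; split => //.
(* The bound on the class in [quot ILH] also bounds [f]: a component of [f] is supported on normal
   words, hence vanishes as soon as its class does. *)
move=> h fh; apply: yg; rewrite pE => /(supported_eq0 bB NB bNh iota_hat_inj) hf.
apply: fh; apply: hf => v v0; apply: fN => v0'; apply: v0.
have [Bv|nBv] := pselect (B v); last first.
  by apply: contrapT => /(part_line_mem bB).
have [k kv] := gmo_homogeneous gmo Bv.
have [hk|hk] := eqVneq h k; last exact: (part_line_part_neq Rg_grading gmo _ kv).
by rewrite hk (part_line_part Rg_grading gmo _ kv).
Qed.

Lemma LM_symbol g x a : symbol g x a -> a <> 0 -> exists u,
  [/\ N u, LM Nbar prec_bar x = coset I u & LM Nhat prec_hat a = coset ILH u].
Proof.
move=> ga a0; have [h [b [u [hb b0 uP]]]] := LM_symbol_exists (symbol_neq0 a0 ga).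
by have [_ ->] := symbol_degree a0 b0 ga hb; exists u.
Qed.

(** The factor 1 of the one-sided cases is the class of the normal word 1, so that all three sides
    lead to products of three normal words. *)
Lemma multipliers_lift x y : multipliers sd Nbar x y -> exists v s,
  [/\ N v, N s, x = coset I v, y = coset I s & multipliers sd Nhat (coset ILH v) (coset ILH s)].
Proof.
case: (sd) => /=.
- by move=> [[v Nv <-] ->]; exists v, 1; rewrite !rmorph1; split => //; split => //; exists v.
- by move=> [-> [v Nv <-]]; exists 1, v; rewrite !rmorph1; split => //; split => //; exists v.
- by move=> [[v Nv <-] [s Ns <-]]; exists v, s; split => //; split; [exists v | exists s].
Qed.

Lemma multipliers_push x y : multipliers sd Nhat x y -> exists v s,
  [/\ N v, N s, x = coset ILH v, y = coset ILH s & multipliers sd Nbar (coset I v) (coset I s)].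
Proof.
case: (sd) => /=.
- by move=> [[v Nv <-] ->]; exists v, 1; rewrite !rmorph1; split => //; split => //; exists v.
- by move=> [-> [v Nv <-]]; exists 1, v; rewrite !rmorph1; split => //; split => //; exists v.
- by move=> [[v Nv <-] [s Ns <-]]; exists v, s; split => //; split; [exists v | exists s].
Qed.

(** The domain hypothesis enters here: the product of the three symbols is nonzero, hence it is the
    symbol that carries the leading word of the product in [quot I]. *)
Lemma LM_product v u s : N v -> N u -> N s -> exists m,
  [/\ N m, LM Nbar prec_bar (coset I v * coset I u * coset I s) = coset I m &
      LM Nhat prec_hat (coset ILH v * coset ILH u * coset ILH s) = coset ILH m].
Proof.
move=> Nv Nu Ns; have [g gv] := symbol_normal Nv.
have [h hu] := symbol_normal Nu; have [k ks] := symbol_normal Ns.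
have nz w : N w -> coset ILH w <> 0 by move=> Nw; apply: (basis_neq0 bNh); exists w.
apply: (LM_symbol (symbolM (symbolM gv hu) ks)).
by move=> /domain[/domain[]|]; exact: nz.
Qed.

(** Lets the non-scalar conditions of the first axiom pass from [quot I] to [quot ILH]: a normal
    word whose class in [quot ILH] is scalar is the word 1. *)
Lemma normal_scalar_hat u : N u ->
  is_scalar (coset ILH u) -> is_scalar (coset I u).
Proof.
move=> Nu us; exists 1; rewrite scale1r.
have /(basis_scalar bNh Nh1) /(_ us) : Nhat (coset ILH u) by exists u.
by rewrite -[1](rmorph1 (coset ILH)) => /(iota_hat_inj Nu N1) ->; rewrite rmorph1.
Qed.

Lemma transfer_monomial_ordering : monomial_ordering sd Nbar prec_bar.
Proof.
split; first exact: transfer_well_order.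
- move=> _ _ _ _ [w Nw <-] [u Nu <-] /multipliers_lift[v [s [Nv Ns -> -> vs]]].
  move=> /(transfer_orderE Nw Nu) wu.
  have [m [Nm -> mE]] := LM_product Nv Nw Ns.
  have [m' [Nm' -> mE']] := LM_product Nv Nu Ns.
  move=> ns ns'; apply/transfer_orderE => //; rewrite -mE -mE'.
  have hw : Nhat (coset ILH w) by exists w.
  have hu : Nhat (coset ILH u) by exists u.
  apply: (mo_mul mo_hat hw hu vs wu).
  + by rewrite mE => /(normal_scalar_hat Nm).
  + by rewrite mE' => /(normal_scalar_hat Nm').
- move=> _ _ _ _ [w Nw <-] [u Nu <-] /multipliers_lift[v [s [Nv Ns -> -> vs]]] vs1.
  have [m [Nm -> mE]] := LM_product Nv Nw Ns => /(iota_bar_inj Nu Nm) um.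
  rewrite -um in mE; apply/transfer_orderE => //.
  have hw : Nhat (coset ILH w) by exists w.
  have hu : Nhat (coset ILH u) by exists u.
  apply: (mo_dvd mo_hat hw hu vs _ (esym mE)).
  (* A multiplier other than 1 is the class of a word other than 1, so the class of that word in
     [quot ILH] differs from 1 too. *)
  rewrite -(rmorph1 (coset I)) in vs1; rewrite -(rmorph1 (coset ILH)).
  by case: vs1 => h; [left | right] => /iota_hat_inj E; apply: h; rewrite E.
Qed.

Lemma transfer_divides u v : N u -> N v ->
  divides sd Nhat prec_hat (coset ILH u) (coset ILH v) ->
  divides sd Nbar prec_bar (coset I u) (coset I v).
Proof.
move=> Nu Nv [_ [_ [/multipliers_push[w [s [Nw Ns -> -> ws]]] E]]].
exists (coset I w), (coset I s); split => //.
have [m [Nm -> mE]] := LM_product Nw Nu Ns.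
by rewrite mE in E; rewrite (iota_hat_inj Nv Nm E).
Qed.

(** * Groebner bases of ideals of the quotient by [I] *)

Section SymbolIdeal.
Variable J : set (quot I).
Hypothesis J_ideal : is_ideal sd J.

Definition symbols (g : Gam) : set (quot ILH) := [set a | exists2 x, J x & symbol g x a].

(** A homogeneous multiplier lifts to an element of [quot I] with that symbol, so the symbols of [J]
    absorb homogeneous multipliers on the sides on which [J] is an ideal. *)
Lemma symbol_ideal_graded :
  graded_ideal Ag sd [set a | forall g, symbols g (part Ag g a)].
Proof.
have [J0 JD JMl JMr] := J_ideal.
apply: (span_graded Ag_grading (Q := symbols)).
- by move=> g a [x _ /symbol_homogeneous].
- by move=> g; exists 0 => //; exact: symbol0.
- move=> g a b [x Jx xa] [y Jy yb]; exists (x + y); [exact: JD | exact: symbolD].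
- move=> side g h a b ga [x Jx xb]; have [y ya] := symbol_lift ga.
  by exists (y * x); [exact: JMl | exact: symbolM].
- move=> side g h a b ga [x Jx xb]; have [y ya] := symbol_lift ga.
  by exists (x * y); [exact: JMr | exact: symbolM].
Qed.

(** Taking every element of [J] with a symbol in [Ghat] avoids a choice of lifts. That this set
    generates [J] follows from divisibility of leading monomials by [divides_ideal_gen]. *)
Lemma transfer_groebner_basis (Ghat : set (quot ILH)) :
  groebner_basis sd Nhat prec_hat [set a | forall g, symbols g (part Ag g a)] Ghat ->
  (forall a, Ghat a -> homogeneous Ag a) ->
  groebner_basis sd Nbar prec_bar J
    [set x | J x /\ exists g a, symbol g x a /\ Ghat a].
Proof.
move=> [G0 Ggen Gdiv] Ghom.
have G'0 x : (J x /\ exists g a, symbol g x a /\ Ghat a) -> x <> 0.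
  by move=> [_ [g [a [xa /G0 a0]]]]; exact: symbol_neq0 xa.
have G'div f : J f -> f <> 0 ->
    exists2 x, J x /\ (exists g a, symbol g x a /\ Ghat a) &
      divides sd Nbar prec_bar (LM Nbar prec_bar x) (LM Nbar prec_bar f).
  move=> Jf f0; have [g [a [u [fa a0 [Nu fE aE]]]]] := LM_symbol_exists f0.
  have [|b Gb] := Gdiv a _ a0.
    have sA h : symbols h `<=` Ag h by move=> c [x _ /symbol_homogeneous].
    have s0 h : symbols h 0 by exists 0; [case: J_ideal | exact: symbol0].
    by apply: (homogeneous_span Ag_grading sA s0 (g := g)); exists f.
  have [h hb] := Ghom b Gb.
  have : [set a | forall g, symbols g (part Ag g a)] b.
    by rewrite -Ggen; exact: sub_ideal_gen.
  (* Being homogeneous, [b] equals its component of degree [h], and so is itself a symbol of some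
     [x] in [J]. *)
  move=> /(_ h); rewrite (part_id decA hb) => -[x Jx xb].
  have [w [Nw xE bE]] := LM_symbol xb (G0 b Gb).
  rewrite aE bE => /(transfer_divides Nw Nu) wu.
  exists x; last by rewrite xE fE.
  by split => //; exists h, b.
split => //.
apply: (divides_ideal_gen bNb transfer_monomial_ordering Nb1 J_ideal _ G'0 G'div).
by move=> x [].
Qed.

End SymbolIdeal.
End Transfer.

Theorem theorem2p10 (d : Order.disp_t) (Gam : orderedSemigroupType d)
  (Gam_wf : well_founded (fun g h : Gam => (g < h)%O))
  (K : fieldType) (R : algType K)
  (gens : seq R) (R_gens : generates gens)
  (Rg : Gam -> set R) (R_graded : grading Rg)
  (B : set R) (B_skew : skew_multiplicative_basis gens B)
  (prec_gr : R -> R -> Prop)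
  (prec_grP : graded_monomial_ordering TwoSided Rg B prec_gr)
  (I : properIdeal R)
  (* A^Gamma_LH = quot ILH; it is nontrivial, being a domain *)
  (ILH : properIdeal R) (ILH_def : ILH = ideal_gen TwoSided (LH Rg @` I) :> set R)
  (sd : side)
  (ALH_domain : is_domain (quot ILH))
  (prec_hat : quot ILH -> quot ILH -> Prop) :
  let N := normal_monomials B prec_gr I in
  let Nhat := coset ILH @` N in
  let Nbar := coset I @` N in
  let ALHg := quot_grading ILH Rg in
  let prec_bar := transfer_order I N prec_hat in
  groebner_theory sd Nhat prec_hat ->
  graded_monomial_ordering sd ALHg Nhat prec_hat ->
  (forall J : set (quot ILH), graded_ideal ALHg sd J ->
     exists G, groebner_basis sd Nhat prec_hat J G /\
               (forall g, G g -> homogeneous ALHg g)) ->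
  admissible_system sd Nbar prec_bar /\
  (forall J : set (quot I), is_ideal sd J ->
     exists G, groebner_basis sd Nbar prec_bar J G).
Proof.
move=> N Nhat Nbar ALHg prec_bar _ gmo_hat hom_gb; split.
  split; first exact: normal_basis B_skew (gmo_admissible prec_grP).2.
  exact: (transfer_monomial_ordering R_graded B_skew prec_grP ILH_def gmo_hat ALH_domain).
move=> J iJ.
(* The symbol ideal may be the whole algebra; the hypothesis covers improper graded ideals as
   well. *)
have [G [Ggb Ghom]] := hom_gb _ (symbol_ideal_graded R_graded ILH_def iJ).
eexists.
exact: (transfer_groebner_basis R_graded B_skew prec_grP ILH_def gmo_hat ALH_domain iJ Ggb Ghom).
Qed.
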